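(* Let $A\in\mathbb{C}^{n\times n}$ be diagonalizable, with eigenvalues $|\lambda_1|\ge|\lambda_2|\ge\cdots\ge|\lambda_n|$, let $C\in\mathbb{C}^{m\times n}$ be such that $(C,A)$ is detectable, and let $Q,\Sigma_0\in\mathbb{C}^{n\times n}$ and $R\in\mathbb{C}^{m\times m}$ be Hermitian and strictly positive definite. Suppose that every equi-block of the system associated with unstable or critically stable eigenvalues (i.e. with eigenvalues of absolute value $>1$ or $=1$) is non-degenerate. Then the critical value of the Kalman filter with intermittent observations for this system is $$p_c=\max\bigl(1-|\lambda_1|^{-2},\,0\bigr).$$
   Context: Kalman filter with intermittent observations: consider $x_{k+1}=Ax_k+w_k$, $y_k=Cx_k+v_k$, with mutually independent Gaussian $w_k$ (mean $0$, covariance $Q$), $v_k$ (mean $0$, covariance $R$) and $x_0$ (mean $\bar x_0$, covariance $\Sigma_0$); the measurement $y_k$ is received iff $\gamma_k=1$, where $(\gamma_k)_{k\ge 0}$ are i.i.d. Bernoulli with $P(\gamma_k=1)=p\in[0,1]$, independent of everything else. The one-step prediction error covariance $P_k$ is the random matrix defined by $P_0=\Sigma_0$ and $$P_{k+1}=AP_kA^H+Q-\gamma_k AP_kC^H(CP_kC^H+R)^{-1}CP_kA^H .$$ (For real matrices $^H$ is the transpose; complex matrices are allowed because a real system is brought to diagonal form over $\mathbb{C}$.) Matrix inequalities are in the positive semidefinite order. $E P_k$ is called bounded if there is a matrix $M$ with $E P_k\le M$ for all $k$, and unbounded otherwise (also written $\sup_k EP_k=+\infty$). The critical value $p_c$ of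 the system is the threshold arrival probability for boundedness: $p_c=\inf\{p\in[0,1]: E P_k \text{ is bounded}\}$. Diagonal standard form: since $A$ is diagonalizable, a change of state coordinates $A\mapsto S^{-1}AS$, $C\mapsto CS$ brings the system to $A=\mathrm{diag}(\lambda_1,\dots,\lambda_n)$, $C=[C_1,\dots,C_n]$. For an index set $\mathcal I=\{i_1<\dots<i_l\}\subset\{1,\dots,n\}$, the block associated with $\mathcal I$ is the subsystem $A_{\mathcal I}=\mathrm{diag}(\lambda_{i_1},\dots,\lambda_{i_l})$, $C_{\mathcal I}=[C_{i_1},\dots,C_{i_l}]$. An equi-block is a block with $|\lambda_{i_1}|=\dots=|\lambda_{i_l}|$. An equi-block is non-degenerate if $C_{\mathcal I}$ has full column rank, and degenerate otherwise. Convention: $|0|^{-2}=+\infty$, so the formula gives $p_c=0$ if $\lambda_1=0$. *)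

(* Defs.v *)
From HB Require Import structures.
From mathcomp Require Import all_boot all_order all_algebra.
From mathcomp Require Import finmap.
From mathcomp Require Import all_classical all_reals all_analysis.
From mathcomp Require Import complex.

Set Implicit Arguments.
Unset Strict Implicit.
Unset Printing Implicit Defensive.

Import Order.TTheory GRing.Theory Num.Theory.

Local Open Scope classical_set_scope.
Local Open Scope ring_scope.
Local Open Scope complex_scope.
Local Open Scope sesquilinear_scope.

Section ComplexMatrices.
Variable K : realType.

(* In the order of K[i], 0 <= z (resp. 0 < z) says that z is real and
   nonnegative (resp. positive). *)
Definition psdmx n (M : 'M[K[i]]_n) : Prop :=
  M \is hermsymmx /\ forall x : 'cV[K[i]]_n, 0 <= (x ^t* *m M *m x) 0 0.

Definition posdefmx n (M : 'M[K[i]]_n) : Prop :=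
  M \is hermsymmx /\
  forall x : 'cV[K[i]]_n, x != 0 -> 0 < (x ^t* *m M *m x) 0 0.

Definition lemx_psd n (M N : 'M[K[i]]_n) : Prop := psdmx (N - M).

(* Some output-injection gain L makes the estimation error dynamics stable. *)
Definition detectable m n (C : 'M[K[i]]_(m, n)) (A : 'M[K[i]]_n) : Prop :=
  exists L : 'M[K[i]]_(n, m),
    forall a : K[i], eigenvalue (A - L *m C) a -> `|a| < 1.

Definition block_output m n (C : 'M[K[i]]_(m, n)) (I : {set 'I_n}) :
  'M[K[i]]_(m, #|I|) := colsub (fun k : 'I_#|I| => enum_val k) C.

Definition equi_block n (lam : 'rV[K[i]]_n) (I : {set 'I_n}) : Prop :=
  forall i j, i \in I -> j \in I -> `|lam 0 i| = `|lam 0 j|.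

Definition nondegenerate_block m n (C : 'M[K[i]]_(m, n)) (I : {set 'I_n}) : Prop :=
  \rank (block_output C I) = #|I|.

(* S is the change of state coordinates bringing (C, A) to the diagonal
   standard form (C *m S, diag_mx lam). *)
Definition diagonalizes n (S A : 'M[K[i]]_n) (lam : 'rV[K[i]]_n) : Prop :=
  S \in unitmx /\ invmx S *m A *m S = diag_mx lam.

(* Error covariance after k steps along the arrival sequence g. *)
Fixpoint kalman_cov m n (A : 'M[K[i]]_n) (C : 'M[K[i]]_(m, n))
    (Q : 'M[K[i]]_n) (R : 'M[K[i]]_m) (Sigma0 : 'M[K[i]]_n)
    (g : nat -> bool) (k : nat) : 'M[K[i]]_n :=
  if k is k'.+1 then
    let P := kalman_cov A C Q R Sigma0 g k' in
    A *m P *m A ^t* + Q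
    - (g k')%:R *: (A *m P *m C ^t* *m invmx (C *m P *m C ^t* + R)
                    *m C *m P *m A ^t*)
  else Sigma0.

End ComplexMatrices.

Section Arrivals.
Context {K : realType} {d : measure_display} {Omega : measurableType d}.
Variables (Pr : probability Omega K) (gamma : nat -> {RV Pr >-> bool}).

Definition mutually_independent : Prop :=
  forall (J : {fset nat}) (B : nat -> set bool),
    Pr (\bigcap_(k in [set` J]) (gamma k @^-1` B k)) =
    (\prod_(k <- J) Pr (gamma k @^-1` B k))%E.

Definition iid_bernoulli (p : K) : Prop :=
  mutually_independent /\ forall k, Pr (gamma k @^-1` [set true]) = p%:E.

(* [fine] sends an infinite or undefined mean to 0; here it is only applied to
   random variables with finitely many values. *)
Definition cexpectation (X : Omega -> K[i]) : K[i] :=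
  fine ('E_Pr[fun w => complex.Re (X w)])%E +i* fine ('E_Pr[fun w => complex.Im (X w)])%E.

Definition mean_kalman_cov m n (A : 'M[K[i]]_n) (C : 'M[K[i]]_(m, n))
    (Q : 'M[K[i]]_n) (R : 'M[K[i]]_m) (Sigma0 : 'M[K[i]]_n) (k : nat) :
    'M[K[i]]_n :=
  \matrix_(i, j) cexpectation
    (fun w => kalman_cov A C Q R Sigma0 (fun l => gamma l w) k i j).

Definition mean_cov_bounded m n (A : 'M[K[i]]_n) (C : 'M[K[i]]_(m, n))
    (Q : 'M[K[i]]_n) (R : 'M[K[i]]_m) (Sigma0 : 'M[K[i]]_n) : Prop :=
  exists M : 'M[K[i]]_n,
    forall k, lemx_psd (mean_kalman_cov A C Q R Sigma0 k) M.

End Arrivals.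

(* The arrival process of each rate p lives on its own probability space; only
   the rates p in [0, 1] matter. *)
Definition critical_value (K : realType) (d : K -> measure_display)
    (Omega : forall p : K, measurableType (d p))
    (Pr : forall p : K, probability (Omega p) K)
    (gamma : forall p : K, nat -> {RV (Pr p) >-> bool})
    m n (A : 'M[K[i]]_n) (C : 'M[K[i]]_(m, n))
    (Q : 'M[K[i]]_n) (R : 'M[K[i]]_m) (Sigma0 : 'M[K[i]]_n) : K :=
  inf [set p : K | 0 <= p <= 1 /\ mean_cov_bounded (gamma p) A C Q R Sigma0].

(* max (1 - |z|^-2, 0) with the convention |0|^-2 = +oo; the case z = 0 is
   explicit because 0^-1 = 0 in K. *)
Definition critical_formula (K : realType) (z : K[i]) : K :=
  if z == 0 then 0 else Num.max (1 - (ComplexField.Normc.normc z) ^- 2) 0.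

(* Main.v *)
Require Import Defs.
From HB Require Import structures.
From mathcomp Require Import all_boot all_order all_algebra.
From mathcomp Require Import finmap.
From mathcomp Require Import all_classical all_reals all_analysis.
From mathcomp Require Import complex.
From mathcomp Require Import ring lra zify.
Import Order.TTheory GRing.Theory Num.Theory.
Local Open Scope ring_scope.
Local Open Scope complex_scope.
Local Open Scope sesquilinear_scope.

Set Implicit Arguments.
Unset Strict Implicit.
Unset Printing Implicit Defensive.

(** Below the threshold, the mean covariance grows by a factor at least
    [(1 - p) |lam_1|^2] per step, along the left eigenvector of [lam_1].

    Above it, completing the square shows that [v^H P_k v] is at most the cost
    of any control of the dual system [z' = A^H z - gamma C^H u] started at
    [z = v], time running backwards from [k].  Non-degeneracy lets one arrival
    act on a single unstable coordinate without touching the others of equal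
    modulus, while two coordinates of different moduli are separated by the
    geometric growth of their ratio.  Hence, if arrivals at times
    [T_0 < ... < T_n] are separated by a large constant gap and [T_i] is used
    for the coordinate [i], moduli being in decreasing order, then the linear
    system for the inputs is diagonally dominant after a diagonal rescaling, and
    all unstable coordinates vanish after [T_n], at a cost [O(rho^(2 T_n))] for
    every [rho > max (1, |lam_1|)].  Since [T_n] is a sum of constant gaps and
    geometric waiting times, [E rho^(2 T_n)] is finite when
    [(1 - p) rho^2 < 1]. *)

Local Notation normc := ComplexField.Normc.normc.

(** * Hermitian forms and completion of the square *)

Section QuadraticForms.
Variable K : realType.
Local Notation F := K[i].

Definition qform n (P : 'M[F]_n) (x : 'cV[F]_n) : F := (x ^t* *m P *m x) 0 0.

Lemma adjmxM m n p (A : 'M[F]_(m, n)) (B : 'M[F]_(n, p)) :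
  (A *m B) ^t* = B ^t* *m A ^t*.
Proof. by rewrite trmx_mul map_mxM. Qed.

Lemma adjmxD m n (A B : 'M[F]_(m, n)) : (A + B) ^t* = A ^t* + B ^t*.
Proof. by rewrite linearD /= map_mxD. Qed.

Lemma adjmxB m n (A B : 'M[F]_(m, n)) : (A - B) ^t* = A ^t* - B ^t*.
Proof. by rewrite linearB /= map_mxB. Qed.

Lemma hermsymmxP n (P : 'M[F]_n) : reflect (P ^t* = P) (P \is hermsymmx).
Proof.
by apply: (iffP (is_hermitianmxP _ _ _)) => [{2}->|{1}<-]; rewrite expr0 scale1r.
Qed.

Lemma hermsymmxD n (P Q : 'M[F]_n) :
  P \is hermsymmx -> Q \is hermsymmx -> P + Q \is hermsymmx.
Proof.
by move=> /hermsymmxP hP /hermsymmxP hQ; apply/hermsymmxP; rewrite adjmxD hP hQ.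
Qed.

Lemma hermsymmxB n (P Q : 'M[F]_n) :
  P \is hermsymmx -> Q \is hermsymmx -> P - Q \is hermsymmx.
Proof.
by move=> /hermsymmxP hP /hermsymmxP hQ; apply/hermsymmxP; rewrite adjmxB hP hQ.
Qed.

Lemma hermsymmxZ n (a : F) (P : 'M[F]_n) :
  a \is Num.real -> P \is hermsymmx -> a *: P \is hermsymmx.
Proof.
move=> ha /hermsymmxP hP; apply/hermsymmxP.
rewrite linearZ /= map_mxZ hP; congr (_ *: _); exact: conj_Creal.
Qed.

Lemma hermsymmx_congr m n (B : 'M[F]_(m, n)) (P : 'M[F]_n) :
  P \is hermsymmx -> B *m P *m B ^t* \is hermsymmx.
Proof.
move=> /hermsymmxP hP; apply/hermsymmxP.
by rewrite !adjmxM trmxCK hP mulmxA.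
Qed.

Lemma hermsymmx_inv n (P : 'M[F]_n) : P \is hermsymmx -> invmx P \is hermsymmx.
Proof.
by move=> /hermsymmxP hP; apply/hermsymmxP; rewrite trmx_inv map_invmx hP.
Qed.

Lemma hermsymmx_scalar n (a : F) : a \is Num.real -> a%:M \is @hermitianmx F n false Num.conj.
Proof.
by move=> ha; apply/hermsymmxP; rewrite tr_scalar_mx map_scalar_mx; congr _%:M; exact: conj_Creal.
Qed.

Lemma psd_qform_ge0 n (P : 'M[F]_n) x : psdmx P -> 0 <= qform P x.
Proof. by case=> _; apply. Qed.

Lemma posdefmx_psd n (P : 'M[F]_n) : posdefmx P -> psdmx P.
Proof.
case=> hP pP; split=> // x; have [->|/pP/ltW //] := eqVneq x 0.
by rewrite mulmx0 mxE.
Qed.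

Lemma posdefmx_unit n (P : 'M[F]_n) : posdefmx P -> P \in unitmx.
Proof.
case=> hP pP; rewrite -row_free_unit -kermx_eq0; apply/eqP/row_matrixP => i.
rewrite row0; apply/eqP/negPn/negP => rn0.
pose x := (row i (kermx P)) ^t*.
have xP : x ^t* *m P = 0.
  by rewrite /x trmxCK; apply/sub_kermxP; rewrite row_sub.
have /pP : x != 0.
  by apply: contraNneq rn0 => x0; rewrite -[row _ _]trmxCK -/x x0 trmx0 map_mx0.
by rewrite xP mul0mx mxE ltxx.
Qed.

Lemma qform0 n (P : 'M[F]_n) : qform P 0 = 0.
Proof. by rewrite /qform mulmx0 mxE. Qed.

Lemma qformD n (P Q : 'M[F]_n) x : qform (P + Q) x = qform P x + qform Q x.
Proof. by rewrite /qform mulmxDr mulmxDl mxE. Qed.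

Lemma qformB n (P Q : 'M[F]_n) x : qform (P - Q) x = qform P x - qform Q x.
Proof. by rewrite /qform mulmxBr mulmxBl !mxE. Qed.

Lemma qformZ n a (P : 'M[F]_n) x : qform (a *: P) x = a * qform P x.
Proof. by rewrite /qform -scalemxAr -scalemxAl mxE. Qed.

Lemma qform_congr m n (B : 'M[F]_(m, n)) (P : 'M[F]_n) x :
  qform (B *m P *m B ^t*) x = qform P (B ^t* *m x).
Proof. by rewrite /qform adjmxM trmxCK !mulmxA. Qed.

Lemma psdmx_congr m n (B : 'M[F]_(m, n)) (P : 'M[F]_n) :
  psdmx P -> psdmx (B *m P *m B ^t*).
Proof.
move=> pP; split; first by case: pP => hP _; apply: hermsymmx_congr.
by move=> x; rewrite -/(qform _ _) qform_congr psd_qform_ge0.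
Qed.

Lemma posdefmx_addl n (P Q : 'M[F]_n) : psdmx P -> posdefmx Q -> posdefmx (P + Q).
Proof.
move=> [hP pP] [hQ pQ]; split; first exact: hermsymmxD.
by move=> x x0; rewrite -/(qform _ _) qformD ltr_wpDl ?pQ // /qform pP.
Qed.

(* The minimum over [u] is attained at [u = W^-1 b]. *)
Lemma complete_square m n (C : 'M[F]_(m, n)) (P : 'M[F]_n) (R : 'M[F]_m) a u
    (W := C *m P *m C ^t* + R) (b := C *m P *m a) :
  P \is hermsymmx -> W \is hermsymmx -> W \in unitmx ->
  qform P (a - C ^t* *m u) + qform R u =
  qform P a - qform (invmx W) b + qform W (u - invmx W *m b).
Proof.
move=> /hermsymmxP hP hW uW; have /hermsymmxP hV := hermsymmx_inv hW.
have {}hW := hermsymmxP _ hW; have VW := mulVmx uW; have WV := mulmxV uW.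
have bE : a ^t* *m P *m C ^t* = b ^t* by rewrite /b !adjmxM hP mulmxA.
(* The inverse becomes an abstract Hermitian [V] with [V W = W V = 1], which is all that the
   expansion uses. *)
move: (invmx W) hV VW WV => V hV VW WV.
rewrite /qform.
have -> : (a - C ^t* *m u) ^t* *m P *m (a - C ^t* *m u) =
    a ^t* *m P *m a - b ^t* *m u - u ^t* *m b + u ^t* *m (C *m P *m C ^t*) *m u.
  rewrite adjmxB adjmxM trmxCK mulmxBr !mulmxBl -bE /b !mulmxA.
  by rewrite opprB addrA addrAC [_ - _ - _]addrAC.
have -> : (u - V *m b) ^t* *m W *m (u - V *m b) =
    u ^t* *m W *m u - b ^t* *m u - u ^t* *m b + b ^t* *m V *m b.
  move: W b hW VW WV {bE uW} => W b hW VW WV.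
  rewrite adjmxB adjmxM hV mulmxBr !mulmxBl !mulmxA.
  rewrite -[u ^t* *m W *m V]mulmxA WV mulmx1.
  rewrite -[b ^t* *m V *m W]mulmxA VW mulmx1.
  by rewrite opprB addrA addrAC.
have -> : u ^t* *m W *m u = u ^t* *m (C *m P *m C ^t*) *m u + u ^t* *m R *m u.
  by rewrite /W mulmxDr mulmxDl.
move: (a ^t* *m P *m a) (b ^t* *m u) (u ^t* *m b) (b ^t* *m V *m b).
move: (u ^t* *m (C *m P *m C ^t*) *m u) (u ^t* *m R *m u) => x1 x2 x3 x4 x5 x6.
by rewrite !mxE; ring.
Qed.

End QuadraticForms.

(** * The Riccati step and its regulator interpretation *)

Section Riccati.
Variables (K : realType) (m n : nat).
Local Notation F := K[i].
Variables (A : 'M[F]_n) (C : 'M[F]_(m, n)) (Q : 'M[F]_n) (R : 'M[F]_m).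

Definition riccati (b : bool) (P : 'M[F]_n) : 'M[F]_n :=
  A *m P *m A ^t* + Q
    - b%:R *: (A *m P *m C ^t* *m invmx (C *m P *m C ^t* + R)
                    *m C *m P *m A ^t*).

Hypotheses (pQ : psdmx Q) (pR : posdefmx R).

Lemma innovation_posdef (P : 'M[F]_n) : psdmx P -> posdefmx (C *m P *m C ^t* + R).
Proof. by move=> pP; apply: posdefmx_addl => //; apply: psdmx_congr. Qed.

Lemma qform_riccati (b : bool) (P : 'M[F]_n) x : psdmx P ->
  qform (riccati b P) x = qform P (A ^t* *m x) + qform Q x
    - b%:R * qform (invmx (C *m P *m C ^t* + R)) (C *m P *m (A ^t* *m x)).
Proof.
move=> [/hermsymmxP hP _]; rewrite /riccati qformB qformZ qformD qform_congr.
congr (_ - _ * _).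
by rewrite /qform !adjmxM !trmxCK hP !mulmxA.
Qed.

(** After an arrival the slack is the square [qform W (u - W^-1 b)] of [complete_square]; without
    one it is the control cost [qform R u]. Hence any control, optimal or not, gives an upper
    bound. *)
Lemma riccati_le_control (b : bool) (P : 'M[F]_n) x u : psdmx P ->
  qform (riccati b P) x <=
  qform P (A ^t* *m x - b%:R *: (C ^t* *m u)) + qform Q x + qform R u.
Proof.
move=> pP; rewrite qform_riccati //; case: b; last first.
  rewrite mul0r scale0r !subr0 lerDl; apply: psd_qform_ge0.
  exact: posdefmx_psd.
have W := innovation_posdef pP.
rewrite scale1r mul1r addrAC [leRHS]addrAC lerD2r.
rewrite complete_square ?posdefmx_unit //; first last.
- by case: W.
- by case: pP.
by rewrite lerDl; apply/psd_qform_ge0/posdefmx_psd.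
Qed.

Lemma riccati_psd (b : bool) (P : 'M[F]_n) : psdmx P -> psdmx (riccati b P).
Proof.
move=> pP; have W := innovation_posdef pP; have hP := pP.1; have hW := W.1.
split.
  rewrite /riccati; apply: hermsymmxB.
    by apply: hermsymmxD; [exact: hermsymmx_congr | case: pQ].
  apply: hermsymmxZ; first exact: realn.
  set V := invmx _; have hV : V \is hermsymmx by apply: hermsymmx_inv.
  have -> : A *m P *m C ^t* *m V *m C *m P *m A ^t* =
            (A *m P *m C ^t*) *m V *m (A *m P *m C ^t*) ^t*.
    by rewrite !adjmxM trmxCK (hermsymmxP _ hP) !mulmxA.
  exact: hermsymmx_congr.
move=> x; rewrite -/(qform _ _) qform_riccati //.
case: b; last by rewrite mul0r subr0 addr_ge0 ?psd_qform_ge0.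
set a := A ^t* *m x; set V := invmx _.
(* At the optimal control the residual square vanishes, so the Riccati value is itself a sum of
   nonnegative costs. *)
have := @complete_square _ _ _ C P R a (V *m (C *m P *m a)) hP hW (posdefmx_unit W).
rewrite subrr qform0 addr0 mul1r => E.
rewrite addrAC -E !addr_ge0 ?psd_qform_ge0 //; exact: posdefmx_psd.
Qed.

(** A lost measurement only adds [Q]; this drives the growth below the threshold. *)
Lemma riccati_ge_open_loop (P : 'M[F]_n) x : psdmx P ->
  qform P (A ^t* *m x) <= qform (riccati false P) x.
Proof.
by move=> pP; rewrite qform_riccati // mul0r subr0 lerDl psd_qform_ge0.
Qed.

Variable Sigma0 : 'M[F]_n.
Hypothesis pS : psdmx Sigma0.

(* The head of the word is the most recent arrival. *)
Fixpoint word_cov (s : seq bool) : 'M[F]_n :=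
  if s is b :: s' then riccati b (word_cov s') else Sigma0.

Lemma word_cov_psd s : psdmx (word_cov s).
Proof. by elim: s => [|b s IH]; [exact: pS | exact: riccati_psd]. Qed.

Lemma kalman_cov_word (g : nat -> bool) k :
  kalman_cov A C Q R Sigma0 g k = word_cov (rev (mkseq g k)).
Proof. by elim: k => //= k ->; rewrite mkseqS rev_rcons. Qed.

(* Read from the most recent step backwards, the covariance is the value of a
   regulator problem for the transposed system, in which the control acts at
   the arrival times. *)
Lemma word_cov_le_cost s (z : nat -> 'cV[F]_n) (u : nat -> 'cV[F]_m) :
  (forall t, (t < size s)%N ->
     z t.+1 = A ^t* *m z t - (nth false s t)%:R *: (C ^t* *m u t)) ->
  qform (word_cov s) (z 0%N) <=
  qform Sigma0 (z (size s)) + \sum_(t < size s) (qform Q (z t) + qform R (u t)).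
Proof.
elim: s z u => [|b s IH] z u hz /=; first by rewrite big_ord0 addr0.
apply: (le_trans (riccati_le_control _ _ (u 0%N) (word_cov_psd s))).
rewrite -(hz 0%N) // big_ord_recl /=.
(* Once the cost of time 0 is cancelled, the rest is the claim for the tail of the word along the
   shifted trajectory. *)
rewrite [leRHS]addrCA -addrA [leRHS]addrC lerD2r.
by apply: (IH (z \o succn) (u \o succn)) => t ht /=; rewrite hz.
Qed.

End Riccati.

(** * Real-valued moduli and entrywise bounds *)

Section ComplexModulus.
Variable K : realType.
Local Notation F := K[i].
Implicit Types z : F.

Lemma normr_normc z : `|z| = (normc z)%:C.
Proof. by rewrite normc_def; case: z. Qed.

Lemma normc_ge0 z : 0 <= normc z.
Proof. by rewrite -ler0c -normr_normc. Qed.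

Lemma le_normr_normc z1 z2 : (`|z1| <= `|z2|) = (normc z1 <= normc z2).
Proof. by rewrite !normr_normc lecR. Qed.

Lemma normc_conj z : normc z^* = normc z.
Proof. by apply: complexI; rewrite -!normr_normc norm_conjC. Qed.

Lemma normcX z k : normc (z ^+ k) = normc z ^+ k.
Proof.
by apply: complexI; rewrite rmorphXn /= -!normr_normc normrX.
Qed.

Lemma le_normc_sum (I : finType) (P : pred I) (f : I -> F) :
  normc (\sum_(i | P i) f i) <= \sum_(i | P i) normc (f i).
Proof.
elim/big_ind2: _ => [|x1 x2 y1 y2 h1 h2|//].
  by rewrite ComplexField.Normc.normc0.
by apply: le_trans (le_normcD _ _) _; apply: lerD.
Qed.

Lemma ge0_normc z : 0 <= z -> z = (normc z)%:C.
Proof. by move=> z0; rewrite -normr_normc ger0_norm. Qed.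

Lemma mulmx_col_bound m n (B : 'M[F]_(m, n)) : exists2 c : K, 0 <= c &
  forall (x : 'cV[F]_n) a, (forall i, normc (x i 0) <= a) ->
  forall i, normc ((B *m x) i 0) <= c * a.
Proof.
exists (\sum_i \sum_j normc (B i j)).
  by apply: sumr_ge0 => i _; apply: sumr_ge0 => j _; apply: normc_ge0.
move=> x a xa i; rewrite mxE; apply: le_trans (le_normc_sum _ _) _.
(* An entry of [x] makes [a] nonnegative; if there is none, [a] may be negative, but both sides are
   then zero. *)
have [j0 _|n0] := pickP (xpredT : pred 'I_n).
  have a0 : 0 <= a := le_trans (normc_ge0 _) (xa j0).
  rewrite mulr_suml (bigD1 i) //= mulr_suml; apply: ler_wpDr.
    apply: sumr_ge0 => k _; apply: mulr_ge0 => //.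
    by apply: sumr_ge0 => j _; apply: normc_ge0.
  apply: ler_sum => j _; rewrite ComplexField.Normc.normcM.
  by apply: ler_wpM2l; rewrite ?normc_ge0.
rewrite big1 => [|j]; last by have := n0 j.
by rewrite big1 ?mul0r // => k _; rewrite big1 // => j; have := n0 j.
Qed.

Lemma qform_bound n (P : 'M[F]_n) : psdmx P -> exists2 c : K, 0 <= c &
  forall (x : 'cV[F]_n) a, (forall i, normc (x i 0) <= a) ->
  qform P x <= (c * a ^+ 2)%:C.
Proof.
move=> pP; have [c c0 hc] := mulmx_col_bound P; exists (n%:R * c) => [|x a xa].
  by rewrite mulr_ge0.
rewrite (ge0_normc (psd_qform_ge0 _ pP)) lecR /qform -mulmxA mxE.
apply: le_trans (le_normc_sum _ _) _.
apply: le_trans (_ : \sum_(i < n) a * (c * a) <= _).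
  apply: ler_sum => i _; rewrite ComplexField.Normc.normcM.
  by apply: ler_pM; rewrite ?normc_ge0 ?hc // !mxE normc_conj.
by rewrite sumr_const card_ord -mulr_natl le_eqVlt; apply/orP; left; apply/eqP; ring.
Qed.

End ComplexModulus.

(** * Weighted diagonally dominant systems *)

Section DiagonalDominance.
Variables (K : realType) (n : nat).
Local Notation F := K[i].
Variables (M : 'M[F]_n) (al : 'I_n -> K).
Hypotheses (al0 : forall i, 0 < al i) (M1 : forall b, M b b = 1)
  (Mdom : forall b, \sum_(i | i != b) normc (M b i) * al i <= al b / 2).

(** At an index [b] maximizing [s = |e_b| / al_b], row [b] gives [s al_b <= c al_b + s al_b / 2],
    hence [s <= 2 c]. *)
Lemma dominant_bound (e : 'cV[F]_n) c :
  (forall b, normc ((M *m e) b 0) <= c * al b) ->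
  forall i, normc (e i 0) <= 2 * c * al i.
Proof.
move=> hv i0.
have [b _ bmax] := arg_maxP (fun i => normc (e i 0) / al i) (erefl (xpredT i0)).
have {}bmax i : normc (e i 0) <= normc (e b 0) / al b * al i.
  by rewrite -ler_pdivrMr ?al0 //; apply: bmax.
suff {i0} bc : normc (e b 0) / al b <= 2 * c.
  by apply: le_trans (bmax _) _; rewrite ler_pM2r.
set s := normc (e b 0) / al b in bmax *.
have eb : normc (e b 0) = s * al b by rewrite /s divfK // gt_eqF.
have : s * al b <= c * al b + s * (al b / 2).
  rewrite -eb.
  have -> : e b 0 = (M *m e) b 0 - \sum_(i | i != b) M b i * e i 0.
    by rewrite mxE (bigD1 b) //= M1 mul1r addrK.
  apply: le_trans (le_normcD _ _) _; rewrite normcN; apply: lerD; first exact: hv.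
  apply: le_trans (le_normc_sum _ _) _.
  apply: le_trans (_ : s * (\sum_(i | i != b) normc (M b i) * al i) <= _).
    rewrite mulr_sumr; apply: ler_sum => i _; rewrite ComplexField.Normc.normcM.
    by rewrite mulrCA; apply: ler_wpM2l; rewrite ?normc_ge0 // mulrC.
  apply: ler_wpM2l => //; rewrite divr_ge0 ?normc_ge0 // ltW //.
by rewrite mulrA -[s * al b / 2]mulrAC -mulrDl ler_pM2r // => ?; lra.
Qed.

Lemma dominant_solve (v : 'cV[F]_n) c : (forall b, normc (v b 0) <= c * al b) ->
  exists2 e : 'cV[F]_n, M *m e = v & forall i, normc (e i 0) <= 2 * c * al i.
Proof.
(* The a priori bound with [c = 0] forces every kernel vector to vanish. *)
move=> hv; have uM : M \in unitmx.
  rewrite -unitmx_tr -row_free_unit -kermx_eq0; apply/eqP/row_matrixP => i.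
  rewrite row0; set x := row i _.
  have xM : M *m x^T = 0.
    apply: trmx_inj; rewrite trmx_mul trmxK trmx0.
    by apply/sub_kermxP; rewrite row_sub.
  apply/rowP => j; rewrite [RHS]mxE; apply: ComplexField.Normc.eq0_normc.
  apply/eqP; rewrite eq_le normc_ge0 andbT.
  have := @dominant_bound x^T 0; rewrite xM => /(_ _ j).
  rewrite mulr0 mul0r mxE; apply=> b.
  by rewrite mxE ComplexField.Normc.normc0 mul0r.
exists (invmx M *m v); first by rewrite mulmxA mulmxV // mul1mx.
by apply: dominant_bound => b; rewrite mulmxA mulmxV // mul1mx.
Qed.

End DiagonalDominance.

(** * Weights for the diagonal rescaling *)

Section ScalingWeights.
Variables (K : realType) (r : nat -> K) (T : nat -> nat) (N n : nat).
Hypotheses (r0 : forall i, 0 < r i) (r_anti : forall i j, (i <= j)%N -> r j <= r i)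
  (gap : forall i, (i < n)%N -> (T i + 2 * N <= T i.+1)%N).

(* Weights interpolating the growth ratios at the times [T i], so that the
   steering system becomes diagonally dominant. *)
Let al i := \prod_(l < i) (r l / r l.+1) ^+ (T l + N).

Let alS i : al i.+1 = al i * (r i / r i.+1) ^+ (T i + N).
Proof. by rewrite /al big_ord_recr. Qed.

Let ratio_ge1 i j : (i <= j)%N -> 1 <= r i / r j.
Proof. by move=> ij; rewrite ler_pdivlMr // mul1r r_anti. Qed.

Let ratio_pow_ge0 i j e : 0 <= (r i / r j) ^+ e.
Proof. by rewrite exprn_ge0 // divr_ge0 ?ltW. Qed.

Let al_gt0 i : 0 < al i.
Proof. by apply: prodr_gt0 => l _; rewrite exprn_gt0 ?divr_gt0. Qed.

Let T_mono i j : (i <= j <= n)%N -> (T i <= T j)%N.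
Proof.
case/andP=> ij; elim: j ij => [|j IH]; first by rewrite leqn0 => /eqP->.
rewrite leq_eqVlt ltnS => /predU1P[-> //|ij jn].
by have := IH ij (ltnW jn); have := gap jn; lia.
Qed.

Let ratio_split (i j k : nat) e :
  (r i / r j) ^+ e * (r j / r k) ^+ e = (r i / r k) ^+ e.
Proof. by rewrite -exprMn mulrA divfK // gt_eqF. Qed.

(** The ratios between [i] and [b] telescope to [r i / r b], and each carries an exponent at least
    [T i + N]. *)
Let al_lower i b : (i <= b <= n)%N -> al i * (r i / r b) ^+ (T i + N) <= al b.
Proof.
case/andP=> ib; elim: b ib => [|b IH].
  by rewrite leqn0 => /eqP-> _; rewrite divff ?gt_eqF // expr1n mulr1.
rewrite leq_eqVlt ltnS => /predU1P[-> _|ib bn].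
  by rewrite divff ?gt_eqF // expr1n mulr1.
rewrite alS -(ratio_split i b) mulrA.
apply: ler_pM; [|exact: ratio_pow_ge0|exact: IH (ltnW bn)|].
  by rewrite mulr_ge0 ?ratio_pow_ge0 // ltW.
by apply: ler_weXn2l; rewrite ?ratio_ge1 // leq_add2r T_mono // ib ltnW.
Qed.

(** The gap [2 * N] gives [T l + N <= T l.+1 - N], so every exponent before [b] is at most
    [T b - N]. *)
Let al_upper i b : (i <= b <= n)%N -> al b <= al i * (r i / r b) ^+ (T b - N).
Proof.
case/andP=> ib; elim: b ib => [|b IH].
  by rewrite leqn0 => /eqP-> _; rewrite divff ?gt_eqF // expr1n mulr1.
rewrite leq_eqVlt ltnS => /predU1P[-> _|ib bn].
  by rewrite divff ?gt_eqF // expr1n mulr1.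
have bn' := ltnW bn; have gb := gap bn.
rewrite alS -(ratio_split i b) mulrA.
apply: ler_pM; [exact: ltW|exact: ratio_pow_ge0| |].
  apply: le_trans (IH ib bn') _; rewrite ler_pM2l ?al_gt0 //.
  by apply: ler_weXn2l; [rewrite ratio_ge1 | lia].
by apply: ler_weXn2l; [rewrite ratio_ge1 | lia].
Qed.

(** The last two bounds say that [a i * r i ^+ T i] over [a b * r b ^+ T i] is at most the [N]-th
    power of the smaller rate over the larger, whichever index comes first. The second bound keeps
    the resulting inputs of order [r 0 ^+ T i]. *)
Lemma scaling_weights : exists a : nat -> K,
  [/\ forall i, 1 <= a i,
      forall i, (i <= n)%N -> a i * r i ^+ T i <= r 0%N ^+ T i,
      forall i b, (i < b <= n)%N ->
        a i * r i ^+ T i * r i ^+ N <= a b * r b ^+ T i * r b ^+ N &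
      forall i b, (b < i <= n)%N ->
        a i * r i ^+ T i * r b ^+ N <= a b * r b ^+ T i * r i ^+ N].
Proof.
exists al; split.
- move=> i; rewrite /al; elim/big_ind: _ => // [x y x1 y1|l _].
    by rewrite -[leLHS]mulr1 ler_pM.
  by rewrite exprn_ege1 // ratio_ge1.
- move=> i ni; have := @al_upper 0%N i ni.
  rewrite [al 0]/al big_ord0 mul1r => h.
  have {}h : al i <= (r 0%N / r i) ^+ T i.
    by apply: le_trans h _; apply: ler_weXn2l; rewrite ?ratio_ge1 ?leq_subr.
  apply: le_trans (_ : (r 0%N / r i) ^+ T i * r i ^+ T i <= _).
    by rewrite ler_pM2r ?exprn_gt0.
  by rewrite -exprMn divfK // gt_eqF.
- move=> i b /andP[ib bn]; have := @al_lower i b; rewrite (ltnW ib) bn => /(_ isT).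
  rewrite -!mulrA -!exprD expr_div_n mulrA.
  by rewrite ler_pdivrMr ?exprn_gt0.
- move=> i b /andP[bi ni]; have := @al_upper b i; rewrite (ltnW bi) ni => /(_ isT).
  (* This makes the truncated subtraction [T i - N] exact. *)
  have Ti : (N <= T i)%N.
    by have := @T_mono b.+1 i; rewrite bi ni => /(_ isT); have := gap (leq_trans bi ni); lia.
  rewrite expr_div_n mulrA ler_pdivlMr ?exprn_gt0 // => h.
  rewrite -{1}(subnK Ti) -{2}(subnK Ti) !exprD.
  have rr : 0 < r i ^+ N * r b ^+ N by rewrite mulr_gt0 ?exprn_gt0.
  rewrite -(ler_pM2r rr) in h; lra.
Qed.

End ScalingWeights.

Lemma geometric_small (K : realType) (k c e : K) : 0 <= k < 1 -> 0 < e ->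
  exists N : nat, c * k ^+ N <= e.
Proof.
move=> /andP[k0 k1] e0.
have kn : `|k| < 1 by rewrite ger0_norm.
have /cvgrPdist_le/(_ (e / (`|c| + 1))) := cvg_expr kn.
have c0 : 0 < `|c| + 1 by rewrite ltr_wpDl.
rewrite divr_gt0 // => /(_ isT) [N _ /(_ N (leqnn N))] /=.
rewrite sub0r normrN ger0_norm ?exprn_ge0 // ler_pdivlMr // => h; exists N.
apply: le_trans h; rewrite mulrC; apply: ler_wpM2l; first exact: exprn_ge0.
by apply: le_trans (ler_norm c) _; rewrite lerDl.
Qed.

(** * Input amplitudes that cancel the unstable coordinates *)

Section Steering.
Variables (K : realType) (n : nat).
Local Notation F := K[i].
Variables (mu : 'I_n.+1 -> F) (B : 'M[F]_n.+1) (rho : K).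
Hypotheses (mu_sort : forall i j : 'I_n.+1, (i <= j)%N -> normc (mu j) <= normc (mu i))
  (mu_le : forall i, normc (mu i) <= rho)
  (B_dual : forall i b, 1 <= normc (mu i) -> normc (mu b) = normc (mu i) ->
     B b i = (b == i)%:R).

(** There are finitely many pairs of distinct moduli, so the largest ratio below 1 works; the
    default 0 serves when there is no such pair. *)
Lemma modulus_gap : exists2 k : K, 0 <= k < 1 &
  forall i b, normc (mu b) < normc (mu i) -> normc (mu b) <= k * normc (mu i).
Proof.
pose P (p : 'I_n.+1 * 'I_n.+1) := normc (mu p.1) < normc (mu p.2).
pose f (p : 'I_n.+1 * 'I_n.+1) := normc (mu p.1) / normc (mu p.2).
exists (\big[Num.max/0]_(p | P p) f p).
  apply/andP; split; first exact: bigmax_ge_id.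
  apply: bigmax_lt => // p Pp; rewrite /f ltr_pdivrMr ?mul1r //.
  by apply: le_lt_trans Pp; apply: normc_ge0.
move=> i b h; rewrite -ler_pdivrMr; last by apply: le_lt_trans h; apply: normc_ge0.
exact: (@le_bigmax_cond _ _ _ 0 (b, i) P f).
Qed.

(** In the unknowns [eps i / mu i ^+ T i] the matrix has unit diagonal and, by duality, zero entries
    between distinct unstable coordinates of equal modulus. [scaling_weights] makes the other
    entries small, with [N] independent of the times [T]. *)
Lemma steering_weights : exists N : nat, forall (T : nat -> nat),
  (forall i, (i < n)%N -> (T i + 2 * N <= T i.+1)%N) ->
  forall (v : 'I_n.+1 -> F) (a : K), (forall b, normc (v b) <= a) ->
  exists eps : 'I_n.+1 -> F,
  [/\ forall i : 'I_n.+1, normc (eps i) <= 2 * a * rho ^+ T i,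
      forall i, normc (mu i) < 1 -> eps i = 0 &
      forall b, 1 <= normc (mu b) -> v b = \sum_(i < n.+1) mu b ^- T i * B b i * eps i].
Proof.
have [k /andP[k0 k1] hk] := modulus_gap.
pose be := \sum_b \sum_i normc (B b i).
have be_ge b i : normc (B b i) <= be.
  rewrite /be (bigD1 b) //= (bigD1 i) //= -addrA lerDl addr_ge0 //.
    by apply: sumr_ge0 => j _; apply: normc_ge0.
  by apply: sumr_ge0 => j _; apply: sumr_ge0 => l _; apply: normc_ge0.
have be0 : 0 <= be := le_trans (normc_ge0 _) (be_ge ord0 ord0).
have k01 : 0 <= k < 1 by rewrite k0.
(* Off-diagonal entries will have weighted size at most [be * k ^+ N]; a row of them must not exceed
   one half. *)
have [N hN] := geometric_small (n.+1%:R * be) k01 (divr_gt0 ltr01 (ltr0n K 2)).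
exists N => T gap v a va.
have a0 : 0 <= a := le_trans (normc_ge0 _) (va ord0).
(* Clamping the index extends the moduli to an antitone sequence on all of [nat]; the maximum with 1
   keeps it positive and does not alter unstable moduli. *)
pose r j := Num.max 1 (normc (mu (inord (minn j n)))).
have r0 j : 0 < r j by rewrite lt_max ltr01.
have rE (i : 'I_n.+1) : 1 <= normc (mu i) -> r i = normc (mu i).
  move=> i1; have -> : r i = Num.max 1 (normc (mu i)); last exact: max_r.
  by rewrite /r (_ : minn i n = i) ?inord_val //; apply/minn_idPl; rewrite -ltnS.
have r_anti i j : (i <= j)%N -> r j <= r i.
  move=> ij; rewrite ge_max !le_max lexx /=; apply/orP; right; apply: mu_sort.
  by rewrite !inordK ?ltnS ?geq_minr //; lia.
have [al [al1 alb al_lo al_up]] := scaling_weights r0 r_anti gap.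
pose U i := 1 <= normc (mu i).
(* Stable coordinates get identity rows and columns, so they decouple from the unstable ones. *)
pose M : 'M[F]_n.+1 := \matrix_(b, i)
  if [&& U b, U i & i != b] then mu b ^- T i * mu i ^+ T i * B b i else (b == i)%:R.
have al0 (i : 'I_n.+1) : 0 < al i by apply: lt_le_trans (al1 i).
have M1 b : M b b = 1 by rewrite mxE !eqxx !andbF.
have Mdom (b : 'I_n.+1) : \sum_(i < n.+1 | i != b) normc (M b i) * al i <= al b / 2.
  apply: le_trans (_ : \sum_(i < n.+1) be * k ^+ N * al b <= _); last first.
    rewrite sumr_const card_ord -[leLHS]mulr_natl !mulrA [leLHS]mulrC.
    by apply: ler_wpM2l => //; [exact: ltW | rewrite -div1r].
  have tm0 : 0 <= be * k ^+ N * al b by rewrite !mulr_ge0 ?exprn_ge0 // ltW.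
  rewrite [leRHS](bigID (fun i => i != b)) /=; apply: ler_wpDr.
    exact: sumr_ge0.
  apply: ler_sum => i ib; rewrite mxE ib andbT eq_sym (negPf ib).
  case: ifP => [/andP[Ub Ui]|_]; last first.
    by rewrite ComplexField.Normc.normc0 mul0r.
  have [eq_r|neq_r] := eqVneq (normc (mu b)) (normc (mu i)).
    by rewrite B_dual // eq_sym (negPf ib) mulr0 ComplexField.Normc.normc0 mul0r.
  rewrite !ComplexField.Normc.normcM ComplexField.Normc.normcV !normcX -(rE _ Ub) -(rE _ Ui).
  have kN : al i * r i ^+ T i <= al b * r b ^+ T i * k ^+ N.
    move: neq_r; rewrite neq_lt => /orP[] lt_r.
      have lt_ib : (i < b)%N.
        by rewrite ltnNge; apply: contraTN lt_r => /mu_sort; rewrite -leNgt.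
      have := al_lo i b; rewrite lt_ib -ltnS ltn_ord => /(_ isT) h.
      rewrite -(ler_pM2r (exprn_gt0 N (r0 i))); apply: le_trans h _.
      rewrite -[leRHS]mulrA -exprMn; apply: ler_wpM2l.
        by rewrite mulr_ge0 ?exprn_ge0 ?(ltW (al0 _)) ?(ltW (r0 _)).
      by apply: lerXn2r; rewrite ?nnegrE ?mulr_ge0 ?(ltW (r0 _)) // (rE _ Ub) (rE _ Ui) hk.
    have lt_bi : (b < i)%N.
      by rewrite ltnNge; apply: contraTN lt_r => /mu_sort; rewrite -leNgt.
    have := al_up i b; rewrite lt_bi -ltnS ltn_ord => /(_ isT) h.
    rewrite -(ler_pM2r (exprn_gt0 N (r0 b))); apply: le_trans h _.
    rewrite -[leRHS]mulrA -exprMn; apply: ler_wpM2l.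
      by rewrite mulr_ge0 ?exprn_ge0 ?(ltW (al0 _)) ?(ltW (r0 _)).
    by apply: lerXn2r; rewrite ?nnegrE ?mulr_ge0 ?(ltW (r0 _)) // (rE _ Ub) (rE _ Ui) hk.
  have rb0 : r b ^+ T i > 0 by rewrite exprn_gt0.
  have -> : (r b ^+ T i)^-1 * r i ^+ T i * normc (B b i) * al i =
     normc (B b i) * (al i * r i ^+ T i / r b ^+ T i) by ring.
  rewrite -[leRHS]mulrA; apply: ler_pM; rewrite ?normc_ge0 ?be_ge //.
    by rewrite divr_ge0 ?mulr_ge0 ?exprn_ge0 ?(ltW (al0 _)) ?(ltW (r0 _)).
  rewrite ler_pdivrMr //; apply: le_trans kN _.
  by rewrite mulrAC [_ * al b]mulrC.
pose v' : 'cV[F]_n.+1 := \col_b if U b then v b else 0.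
have v'a (b : 'I_n.+1) : normc (v' b 0) <= a * al b.
  apply: le_trans (_ : a <= _); last by rewrite ler_peMr.
  by rewrite mxE; case: ifP => _ //; rewrite ComplexField.Normc.normc0.
have [e Me ea] := dominant_solve al0 M1 Mdom v'a.
(* Undo the rescaling, with no input spent on stable coordinates. *)
exists (fun i => if U i then mu i ^+ T i * e i 0 else 0); split=> [i|i|b Ub].
- case: ifP => [Ui|_]; last first.
    rewrite ComplexField.Normc.normc0 !mulr_ge0 // exprn_ge0 //.
    exact: le_trans (normc_ge0 _) (mu_le i).
  rewrite ComplexField.Normc.normcM normcX -(rE _ Ui).
  apply: le_trans (_ : r i ^+ T i * (2 * a * al i) <= _).
    by apply: ler_wpM2l => //; rewrite exprn_ge0 // ltW.
  rewrite mulrCA; apply: ler_wpM2l; first by rewrite mulr_ge0.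
  rewrite mulrC; apply: le_trans (alb i _) _; first by rewrite -ltnS.
  (* One unstable coordinate makes the leading one unstable, so that [r 0] is a true modulus,
     bounded by [rho]. *)
  have U0 : U ord0 by rewrite /U; apply: le_trans Ui _; apply: mu_sort.
  rewrite -[0%N]/(val (@ord0 n)) (rE _ U0) lerXn2r ?nnegrE ?normc_ge0 //.
  by rewrite (le_trans (normc_ge0 (mu i))).
- by rewrite ltNge => /negPf; rewrite /U => ->.
- have {}Ub : U b := Ub.
  have := congr1 (fun x : 'cV[F]_n.+1 => x b 0) Me; rewrite !mxE Ub => <-.
  apply: eq_bigr => i _; rewrite mxE Ub /=.
  have [-> /=|ib] := eqVneq i b.
    rewrite andbF mul1r Ub B_dual // eqxx mulr1 mulKf //.
    rewrite expf_neq0 //; apply: contraTneq Ub => mu0.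
    by rewrite /U mu0 ComplexField.Normc.normc0 -ltNge ltr01.
  rewrite andbT; case: ifP => [Ui|_]; first by rewrite !mulrA; ring.
  by rewrite mul0r mulr0.
Qed.

End Steering.

(** * Steered trajectories and their cost envelope *)

Section SteeringTrajectory.
Variables (K : realType) (n m : nat).
Local Notation F := K[i].
Variables (mu : 'rV[F]_n.+1) (G : 'M[F]_(n.+1, m)) (D : 'M[F]_(m, n.+1)) (rho : K).
Hypotheses (mu_sort : forall i j : 'I_n.+1, (i <= j)%N ->
    normc (mu 0 j) <= normc (mu 0 i))
  (mu_le : forall i, normc (mu 0 i) <= rho) (rho1 : 1 < rho)
  (GD_dual : forall i b, 1 <= normc (mu 0 i) -> normc (mu 0 b) = normc (mu 0 i) ->
     (G *m D) b i = (b == i)%:R).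

(** Envelope for states and inputs: growth at rate [rho] up to the last arrival used, [tau], then
    decay at the stable rate [k]. *)
Definition profile (k : K) (tau t : nat) : K :=
  if (t <= tau)%N then rho ^+ t else rho ^+ tau * k ^+ (t - tau).

Lemma stable_modulus_gap : exists2 k : K, 0 <= k < 1 &
  forall i, normc (mu 0 i) < 1 -> normc (mu 0 i) <= k.
Proof.
exists (\big[Num.max/0]_(i | normc (mu 0 i) < 1) normc (mu 0 i)).
  by rewrite bigmax_ge_id bigmax_lt.
by move=> i hi; apply: (@le_bigmax_cond _ _ _ 0 i (fun i => normc (mu 0 i) < 1)).
Qed.

(** By superposition, the state is the free evolution minus the responses to the inputs already
    applied. The amplitudes of [steering_weights] annihilate the unstable coordinates at time [T n],
    and only stable decay remains. *)
Lemma steering_trajectory : exists (N : nat) (c k : K),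
  [/\ 0 <= c, 0 <= k < 1 &
  forall (T : nat -> nat), (forall i, (i <= n)%N -> (0 < T i)%N) ->
  (forall i, (i < n)%N -> (T i + 2 * N <= T i.+1)%N) ->
  forall (v : 'cV[F]_n.+1) (a : K), (forall b, normc (v b 0) <= a) ->
  exists (y : nat -> 'cV[F]_n.+1) (u : nat -> 'cV[F]_m),
  [/\ y 0%N = v, forall t, y t.+1 = diag_mx mu *m y t - G *m u t,
      forall t, (forall i, (i <= n)%N -> T i != t.+1) -> u t = 0,
      forall t b, normc (y t b 0) <= c * a * profile k (T n) t &
      forall t j, normc (u t j 0) <= c * a * profile k (T n) t]].
Proof.
have [k k01 hk] := stable_modulus_gap; have /andP[k0 _] := k01.
pose B := G *m D.
have [N hN] := @steering_weights _ _ (fun i => mu 0 i) B rho mu_sort mu_le GD_dual.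
pose be := \sum_b \sum_i normc (B b i).
have be_ge b i : normc (B b i) <= be.
  rewrite /be (bigD1 b) //= (bigD1 i) //= -addrA lerDl addr_ge0 //.
    by apply: sumr_ge0 => j _; apply: normc_ge0.
  by apply: sumr_ge0 => j _; apply: sumr_ge0 => l _; apply: normc_ge0.
pose de := \sum_j \sum_i normc (D j i).
have de_ge j : \sum_i normc (D j i) <= de.
  rewrite /de (bigD1 j) //= lerDl.
  by apply: sumr_ge0 => l _; apply: sumr_ge0 => i _; apply: normc_ge0.
have be0 : 0 <= be := le_trans (normc_ge0 _) (be_ge ord0 ord0).
have de0 : 0 <= de.
  by apply: sumr_ge0 => l _; apply: sumr_ge0 => i _; apply: normc_ge0.
have rho0 : 0 < rho := lt_trans ltr01 rho1.
(* In [cy], the 1 is the free evolution and the rest the [n.+1] responses. The factor [rho] in [cu]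
   comes from an input at time [t] having size of order [rho ^+ t.+1]. *)
pose cy := 1 + n.+1%:R * (2 * be); pose cu := 2 * rho * de.
have cy0 : 0 <= cy by rewrite addr_ge0 // !mulr_ge0.
have cu0 : 0 <= cu by rewrite !mulr_ge0 // ltW.
have p0 tau t : 0 <= profile k tau t.
  by rewrite /profile; case: ifP => _; rewrite ?mulr_ge0 ?exprn_ge0 // ltW.
exists N, (cy + cu), k; split=> //; first exact: addr_ge0.
move=> T T0 gap v a va.
have a0 : 0 <= a := le_trans (normc_ge0 _) (va ord0).
have T_mono (i : 'I_n.+1) : (T i <= T n)%N.
  have h j d : (j + d <= n)%N -> (T j <= T (j + d))%N.
    elim: d => [|d IH]; first by rewrite addn0.
    by rewrite addnS => jd; have := IH (ltnW jd); have := gap _ jd; lia.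
  by have := h i (n - i)%N; rewrite subnKC ?leq_ord //; apply.
have [eps [eps_le eps0 veq]] := hN T gap (fun b => v b 0) a va.
pose y t : 'cV[F]_n.+1 := \col_b (mu 0 b ^+ t * v b 0 -
  \sum_(i < n.+1 | (T i <= t)%N) mu 0 b ^+ (t - T i) * B b i * eps i).
(* An input applied at time [T i - 1] first shows in the state at time [T i]. *)
pose u t : 'cV[F]_m := \sum_(i < n.+1 | T i == t.+1) eps i *: col i D.
have y_early t b : normc (y t b 0) <= cy * a * rho ^+ t.
  have mut s : normc (mu 0 b ^+ s) <= rho ^+ s.
    by rewrite normcX lerXn2r ?nnegrE ?normc_ge0 // ltW.
  rewrite mxE; apply: le_trans (le_normcD _ _) _; rewrite normcN.
  rewrite /cy mulrDl mul1r mulrDl; apply: lerD.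
    by rewrite ComplexField.Normc.normcM mulrC; apply: ler_pM; rewrite ?normc_ge0.
  apply: le_trans (le_normc_sum _ _) _.
  apply: le_trans (_ : \sum_(i < n.+1) 2 * be * a * rho ^+ t <= _); last first.
    by rewrite sumr_const card_ord -[leLHS]mulr_natl !mulrA.
  have tm0 : 0 <= 2 * be * a * rho ^+ t by rewrite !mulr_ge0 // exprn_ge0 // ltW.
  rewrite [leRHS](bigID (fun i : 'I_n.+1 => T i <= t)%N) /=; apply: ler_wpDr.
    exact: sumr_ge0.
  apply: ler_sum => i Ti; rewrite !ComplexField.Normc.normcM.
  have -> : 2 * be * a * rho ^+ t = rho ^+ (t - T i) * be * (2 * a * rho ^+ T i).
    by rewrite -{1}(subnK Ti) exprD; ring.
  by apply: ler_pM; rewrite ?mulr_ge0 ?normc_ge0 //; apply: ler_pM; rewrite ?normc_ge0.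
exists y, u; split.
- apply/colP => b; rewrite mxE expr0 mul1r big_pred0 ?subr0 // => i.
  by rewrite leqNgt T0 // -ltnS.
- move=> t; apply/colP => b.
  have Gu : (G *m u t) b 0 = \sum_(i < n.+1 | T i == t.+1) B b i * eps i.
    rewrite /u mulmx_sumr summxE; apply: eq_bigr => i _.
    rewrite -scalemxAr [LHS]mxE mulrC; congr (_ * _).
    by rewrite !mxE; apply: eq_bigr => j _; rewrite mxE.
  rewrite [RHS]mxE [X in _ + X]mxE Gu mul_diag_mx !mxE mulrBr exprS mulrA -addrA -opprD.
  congr (_ - _); rewrite (bigID (fun i : 'I_n.+1 => T i == t.+1)) /= addrC.
  congr (_ + _); last first.
    apply: eq_big => [i|i /andP[_ /eqP->]].
      by case: eqP => [->|_]; rewrite ?leqnn ?andbF.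
    by rewrite subnn expr0 mul1r.
  rewrite mulr_sumr; apply: eq_big => [i|i].
    by rewrite andbC -ltn_neqAle ltnS.
  move=> /andP[h1 h2]; have Ti : (T i <= t)%N by lia.
  by rewrite subSn // exprS !mulrA.
- move=> t hT; rewrite /u big_pred0 // => i; apply/negbTE/hT.
  by rewrite -ltnS.
- move=> t b; rewrite /profile; case: leqP => ht.
    apply: le_trans (y_early t b) _; apply: ler_wpM2r; first by rewrite exprn_ge0 ?ltW.
    by apply: ler_wpM2r => //; rewrite lerDl.
  (* All inputs have acted by time [T n], so each coordinate then evolves freely. *)
  have yt : y t b 0 = mu 0 b ^+ (t - T n) * y (T n) b 0.
    rewrite !mxE mulrBr mulrA -exprD subnK ?(ltW ht) //; last exact: ltnW.
    congr (_ - _); rewrite mulr_sumr; apply: eq_big => [i|i Ti].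
      by rewrite T_mono (leq_trans (T_mono i) (ltnW ht)).
    rewrite !mulrA -exprD; congr (_ ^+ _ * _ * _); have := T_mono i; lia.
  rewrite yt ComplexField.Normc.normcM mulrA.
  have [b1|b1] := ltP (normc (mu 0 b)) 1.
    rewrite mulrC; apply: ler_pM; rewrite ?normc_ge0 //; last first.
      rewrite normcX lerXn2r ?nnegrE ?normc_ge0 //; exact: hk.
    apply: le_trans (y_early _ b) _; apply: ler_wpM2r.
      by rewrite exprn_ge0 ?ltW.
    by apply: ler_wpM2r => //; rewrite lerDl.
  have mub : mu 0 b != 0.
    by apply: contraTneq b1 => ->; rewrite ComplexField.Normc.normc0 -ltNge ltr01.
  have -> : y (T n) b 0 = 0.
    rewrite mxE veq // mulr_sumr; apply/eqP; rewrite subr_eq0; apply/eqP.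
    apply: eq_big => [i|i _]; first by rewrite T_mono.
    by rewrite !mulrA -expfB_cond ?(negPf mub) ?add0n ?T_mono.
  rewrite ComplexField.Normc.normc0 mulr0 !mulr_ge0 ?exprn_ge0 ?(ltW rho0) //.
  exact: addr_ge0.
- move=> t j; have [ht|ht] := leqP (T n) t.
    rewrite /u big_pred0 => [|i].
      rewrite mxE ComplexField.Normc.normc0 !mulr_ge0 //; exact: addr_ge0.
    by apply/negbTE; have := T_mono i; lia.
  rewrite /profile (ltnW ht) /u summxE; apply: le_trans (le_normc_sum _ _) _.
  apply: le_trans (_ : \sum_(i < n.+1) 2 * rho * a * rho ^+ t * normc (D j i) <= _).
    have tm0 (i : 'I_n.+1) : 0 <= 2 * rho * a * rho ^+ t * normc (D j i).
      by rewrite !mulr_ge0 ?normc_ge0 ?exprn_ge0 // ltW.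
    rewrite [leRHS](bigID (fun i : 'I_n.+1 => T i == t.+1)) /=; apply: ler_wpDr.
      by apply: sumr_ge0.
    apply: ler_sum => i /eqP Ti; rewrite !mxE ComplexField.Normc.normcM.
    apply: ler_wpM2r; first exact: normc_ge0.
    apply: le_trans (eps_le i) _; rewrite Ti exprS le_eqVlt; apply/orP; left.
    by apply/eqP; ring.
  rewrite -mulr_sumr.
  apply: le_trans (_ : 2 * rho * a * rho ^+ t * de <= _).
    by apply: ler_wpM2l => //; rewrite !mulr_ge0 ?exprn_ge0 // ltW.
  have -> : 2 * rho * a * rho ^+ t * de = cu * a * rho ^+ t by rewrite /cu; ring.
  apply: ler_wpM2r; first by rewrite exprn_ge0 ?ltW.
  by apply: ler_wpM2r => //; rewrite lerDr.
Qed.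

(** Two geometric sums, of ratio [rho ^+ 2] before [tau] and [k ^+ 2] from [tau] on. *)
Lemma sum_profile_le k tau s : 0 <= k < 1 -> (tau <= s)%N ->
  \sum_(t < s.+1) profile k tau t ^+ 2 <=
  (1 / (rho ^+ 2 - 1) + 1 / (1 - k ^+ 2)) * (rho ^+ 2) ^+ tau.
Proof.
move=> /andP[k0 k1] ts.
have r1 : 0 < rho ^+ 2 - 1 by rewrite subr_gt0 exprn_egt1.
have k21 : 0 < 1 - k ^+ 2 by rewrite subr_gt0 exprn_ilt1.
have rt0 : 0 <= (rho ^+ 2) ^+ tau by rewrite !exprn_ge0 // ltW // (lt_trans ltr01).
rewrite -(big_mkord xpredT (fun t => profile k tau t ^+ 2)).
rewrite (@big_cat_nat _ _ _ tau) //=; last exact: leqW.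
rewrite mulrDl; apply: lerD.
  rewrite big_mkord.
  have -> : \sum_(i < tau) profile k tau i ^+ 2 = \sum_(i < tau) (rho ^+ 2) ^+ i.
    by apply: eq_bigr => i _; rewrite /profile (ltnW (ltn_ord i)) exprAC.
  rewrite div1r mulrC ler_pdivlMr // mulrC -subrX1.
  by rewrite gerBl.
rewrite -{1}[tau]add0n big_addn big_mkord.
have -> : \sum_(i < s.+1 - tau) profile k tau (i + tau) ^+ 2 =
    \sum_(i < s.+1 - tau) (rho ^+ 2) ^+ tau * (k ^+ 2) ^+ i.
  apply: eq_bigr => i _; rewrite /profile addnK.
  case: leqP => [h|_]; last by rewrite exprMn ![(_ ^+ _) ^+ 2]exprAC.
  have -> : val i = 0%N by move: h; rewrite /=; lia.
  by rewrite add0n mulr1 exprAC.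
rewrite -mulr_sumr mulrC; apply: ler_wpM2r => //.
rewrite ler_pdivlMr // mulrC -opprB mulNr -subrX1 opprB.
by rewrite gerBl !exprn_ge0.
Qed.

End SteeringTrajectory.

(** * Selection of well-separated arrivals in a word *)

(* Number of letters read until [r] true letters have been selected, where
   [w] letters are skipped before the first selection and [g] letters after
   every selection. *)
Fixpoint delay (g r w : nat) (s : seq bool) : nat :=
  match r, s with
  | r'.+1, b :: s' =>
      (if w is w'.+1 then delay g r w' s'
       else if b then delay g r' g s' else delay g r 0 s').+1
  | _, _ => 0
  end.

Lemma delay_le_size g r w s : (delay g r w s <= size s)%N.
Proof.
elim: s r w => [|b s IH] [|r] [|w] //=; rewrite ltnS //.
by case: b.
Qed.

(** The first alternative covers a word that ends before the last selection. Positions count from 1,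
    in agreement with an input at index [T i - 1] acting on the state at time [T i]. *)
Lemma delay_times g r w s : delay g r.+1 w s = size s \/
  exists T : nat -> nat,
  [/\ (w < T 0)%N, forall i, (i <= r)%N -> (0 < T i)%N && nth false s (T i).-1,
      forall i, (i < r)%N -> (T i + g <= T i.+1)%N & T r = delay g r.+1 w s].
Proof.
elim: s r w => [|b s IH] r w; first by left.
(* When the head is not selected, the positions found in the tail all move by one. *)
have shift w0 w1 : (w1 <= w0.+1)%N ->
    delay g r.+1 w1 (b :: s) = (delay g r.+1 w0 s).+1 ->
    delay g r.+1 w1 (b :: s) = size (b :: s) \/
    exists T : nat -> nat,
    [/\ (w1 < T 0)%N,
        forall i, (i <= r)%N -> (0 < T i)%N && nth false (b :: s) (T i).-1,
        forall i, (i < r)%N -> (T i + g <= T i.+1)%N &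
        T r = delay g r.+1 w1 (b :: s)].
  move=> w01 ->; have [->|[T [T0 Tb Tg Tr]]] := IH r w0; first by left.
  right; exists (fun i => (T i).+1); split=> [|i ir|i ir|]; last by rewrite Tr.
  - by lia.
  - by have /andP[] := Tb i ir; case: (T i).
  - by rewrite addSn ltnS Tg.
case: w => [|w]; last by apply: (shift w).
case: b shift => shift; last by apply: (shift 0%N).
case: r IH shift => [|r] IH _.
  by right; exists (fun=> 1%N); split=> //=; case: (s).
have [/= ->|[T [T0 Tb Tg Tr]]] := IH r g; first by left.
right; exists (fun i => if i is j.+1 then (T j).+1 else 1%N).
split=> [//|[|i] ir|[|i] ir|] //=.
- by have /andP[] := Tb i ir; case: (T i).
- by rewrite add1n ltnS ltnW.
- by rewrite addSn ltnS Tg.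
- by rewrite Tr.
Qed.

(** * Covariance bound along a fixed arrival word *)

Section PathwiseBound.
Variables (K : realType) (m n : nat).
Local Notation F := K[i].
Variables (A : 'M[F]_n.+1) (C : 'M[F]_(m, n.+1)) (Q : 'M[F]_n.+1) (R : 'M[F]_m)
  (Sigma0 S : 'M[F]_n.+1) (lam : 'rV[F]_n.+1).
Hypotheses (hdiag : diagonalizes S A lam) (pQ : psdmx Q) (pR : posdefmx R)
  (pS : psdmx Sigma0).

Let mu : 'rV[F]_n.+1 := map_mx Num.conj lam.

(** The change of variable [z = S^-H y] turns the dual system into one with diagonal dynamics, of
    conjugate eigenvalues. *)
Lemma dual_dynamics (y : 'cV[F]_n.+1) (u : 'cV[F]_m) :
  (invmx S) ^t* *m (diag_mx mu *m y - (C *m S) ^t* *m u) =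
  A ^t* *m ((invmx S) ^t* *m y) - C ^t* *m u.
Proof.
have [uS SAS] := hdiag.
have Sinv : (invmx S) ^t* *m S ^t* = 1%:M by rewrite -adjmxM mulmxV // trmx1 map_mx1.
have -> : diag_mx mu = S ^t* *m A ^t* *m (invmx S) ^t*.
  by rewrite -!adjmxM mulmxA SAS tr_diag_mx map_diag_mx.
by rewrite adjmxM mulmxBr !mulmxA Sinv !mul1mx.
Qed.

Lemma word_cov_profile_bound (rho k : K) : 1 < rho -> 0 <= k < 1 ->
  exists2 c, 0 <= c & forall s tau a (y : nat -> 'cV[F]_n.+1) (u : nat -> 'cV[F]_m),
  (tau <= size s)%N ->
  (forall t, (t < size s)%N ->
     y t.+1 = diag_mx mu *m y t - (C *m S) ^t* *m ((nth false s t)%:R *: u t)) ->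
  (forall t b, (t <= size s)%N -> normc (y t b 0) <= a * profile rho k tau t) ->
  (forall t j, (t <= size s)%N -> normc (u t j 0) <= a * profile rho k tau t) ->
  qform (word_cov A C Q R Sigma0 s) ((invmx S) ^t* *m y 0%N) <=
  (c * a ^+ 2 * (rho ^+ 2) ^+ tau)%:C.
Proof.
move=> rho1 k01.
have [cz cz0 hz] := mulmx_col_bound ((invmx S) ^t*).
have [cS cS0 hS] := qform_bound pS; have [cQ cQ0 hQ] := qform_bound pQ.
have [cR cR0 hR] := qform_bound (posdefmx_psd pR).
set cp := 1 / (rho ^+ 2 - 1) + 1 / (1 - k ^+ 2).
have cp0 : 0 <= cp.
  case/andP: k01 => k0 k1.
  by rewrite addr_ge0 // divr_ge0 // subr_ge0 ?exprn_ege1 ?exprn_ile1 // ltW.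
(* Terminal and running state costs pay [cz ^+ 2] for the return to the original coordinates; the
   input cost does not. *)
pose M := (cS + cQ) * cz ^+ 2 + cR.
have M0 : 0 <= M by rewrite addr_ge0 // mulr_ge0 ?addr_ge0 // exprn_ge0.
exists (M * cp) => [|s tau a y u ts hy ya ua]; first exact: mulr_ge0.
pose z t := (invmx S) ^t* *m y t.
have zrec t : (t < size s)%N ->
    z t.+1 = A ^t* *m z t - (nth false s t)%:R *: (C ^t* *m u t).
  by move=> ht; rewrite /z hy // dual_dynamics scalemxAr.
have za t b : (t <= size s)%N -> normc (z t b 0) <= cz * (a * profile rho k tau t).
  by move=> ht; apply: hz => i; apply: ya.
apply: le_trans (word_cov_le_cost pQ pR pS zrec) _.
(* The terminal cost is absorbed as the term [t = size s] of the profile sum. *)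
apply: le_trans (_ : (\sum_(t < (size s).+1)
    (M * a ^+ 2) * profile rho k tau t ^+ 2)%:C <= _); last first.
  rewrite lecR -mulr_sumr.
  apply: le_trans (ler_wpM2l _ (sum_profile_le rho1 k01 ts)) _.
    by rewrite mulr_ge0 // sqr_ge0.
  by rewrite le_eqVlt; apply/orP; left; apply/eqP; rewrite /cp; ring.
rewrite big_ord_recr /= rmorphD rmorph_sum addrC /=; apply: lerD; last first.
  apply: le_trans (hS _ _ (fun b => za _ b (leqnn _))) _; rewrite lecR.
  set p := profile _ _ _ _.
  have -> : cS * (cz * (a * p)) ^+ 2 = cS * cz ^+ 2 * (a ^+ 2 * p ^+ 2) by ring.
  rewrite -[leRHS]mulrA; apply: ler_wpM2r; first by rewrite mulr_ge0 ?sqr_ge0.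
  by rewrite /M mulrDl -addrA lerDl addr_ge0 // mulr_ge0 // sqr_ge0.
apply: ler_sum => t _; have ht := ltnW (ltn_ord t).
apply: le_trans (lerD (hQ _ _ (fun b => za _ b ht)) (hR _ _ (fun j => ua _ j ht))) _.
rewrite -rmorphD lecR /=; set p := profile _ _ _ _.
have -> : cQ * (cz * (a * p)) ^+ 2 + cR * (a * p) ^+ 2 =
  (cQ * cz ^+ 2 + cR) * (a ^+ 2 * p ^+ 2) by ring.
rewrite -[leRHS]mulrA; apply: ler_wpM2r; first by rewrite mulr_ge0 ?sqr_ge0.
by rewrite /M mulrDl lerD2r lerDr mulr_ge0 // sqr_ge0.
Qed.

Hypotheses (lam_sort : forall i j : 'I_n.+1, (i <= j)%N ->
    normc (lam 0 j) <= normc (lam 0 i))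
  (hnondeg : forall I : {set 'I_n.+1}, equi_block lam I ->
       (forall i, i \in I -> 1 <= `|lam 0 i|) -> nondegenerate_block (C *m S) I).

(** The coordinates with the modulus of an unstable [lam 0 i] form an equi-block. Its output columns
    are independent, so the adjoint block has a right inverse, whose columns are the required
    inputs. *)
Lemma dual_inputs : exists D : 'M[F]_(m, n.+1),
  forall i b, 1 <= normc (lam 0 i) -> normc (lam 0 b) = normc (lam 0 i) ->
    ((C *m S) ^t* *m D) b i = (b == i)%:R.
Proof.
suff : forall i, exists f : 'cV[F]_m, 1 <= normc (lam 0 i) ->
    forall b, normc (lam 0 b) = normc (lam 0 i) ->
    ((C *m S) ^t* *m f) b 0 = (b == i)%:R.
  move=> /fin_all_exists[f hf]; exists (\matrix_(j, i) f i j 0) => i b i1 bi.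
  rewrite -(hf i i1 b bi) !mxE; apply: eq_bigr => j _; by rewrite [X in _ * X]mxE.
move=> i; have [i1|] := boolP (1 <= normc (lam 0 i)); last by exists 0.
pose I := [set b | normc (lam 0 b) == normc (lam 0 i)].
have iI : i \in I by rewrite inE.
have : nondegenerate_block (C *m S) I.
  apply: hnondeg => [b1 b2|b]; rewrite !inE.
    by move=> /eqP h1 /eqP h2; rewrite !normr_normc h1 h2.
  by move=> /eqP h; rewrite normr_normc h lecR.
rewrite /nondegenerate_block => rk.
have /row_freeP[X hX] : row_free ((block_output (C *m S) I) ^t*).
  by rewrite /row_free mxrank_map mxrank_tr rk.
exists (col (enum_rank_in iI i) X) => _ b /eqP bI0.
have bI : b \in I by rewrite inE.
have := congr1 (fun Y : 'M[F]_(#|I|) => Y (enum_rank_in iI b) (enum_rank_in iI i)) hX.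
rewrite /= [in RHS]mxE (can_in_eq (enum_rankK_in iI)) // => <-.
rewrite !mxE; apply: eq_bigr => j _; rewrite !mxE; congr (Num.conj _ * _).
by apply: eq_bigr => l _; rewrite enum_rankK_in.
Qed.

(** With [n.+1] separated arrivals in the word, the steering trajectory is used. Otherwise the delay
    is the whole length, and the zero input already stays below [rho ^+ t]. *)
Lemma word_cov_delay_bound (rho : K) : 1 < rho ->
  (forall i, normc (lam 0 i) <= rho) ->
  exists (g : nat) (c : K), 0 <= c /\
  forall s (x : 'cV[F]_n.+1) a, (forall b, normc (x b 0) <= a) ->
  qform (word_cov A C Q R Sigma0 s) x <=
  (c * a ^+ 2 * (rho ^+ 2) ^+ delay g n.+1 0 s)%:C.
Proof.
move=> rho1 lam_le.
have [uS _] := hdiag.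
have muE i : normc (mu 0 i) = normc (lam 0 i) by rewrite mxE normc_conj.
have [D hD] := dual_inputs.
have mu_sort (i j : 'I_n.+1) : (i <= j)%N -> normc (mu 0 j) <= normc (mu 0 i).
  by rewrite !muE; apply: lam_sort.
have mu_le i : normc (mu 0 i) <= rho by rewrite muE.
have GD i b : 1 <= normc (mu 0 i) -> normc (mu 0 b) = normc (mu 0 i) ->
    ((C *m S) ^t* *m D) b i = (b == i)%:R by rewrite !muE; apply: hD.
have [N [c [k [c0 k01 hN]]]] := steering_trajectory mu_sort mu_le rho1 GD.
have [cS cS0 hS] := mulmx_col_bound (S ^t*).
have [cp cp0 hp] := word_cov_profile_bound rho1 k01.
have c10 : 0 <= c + 1 by rewrite addr_ge0.
(* The 1 added to [c] pays for the uncontrolled trajectory. *)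
exists (2 * N)%N, (cp * ((c + 1) * cS) ^+ 2); split=> [|s x a xa].
  by rewrite mulr_ge0 // sqr_ge0.
have a0 : 0 <= a := le_trans (normc_ge0 _) (xa ord0).
have xE : x = (invmx S) ^t* *m (S ^t* *m x).
  by rewrite mulmxA -adjmxM mulmxV // trmx1 map_mx1 mul1mx.
have va b : normc ((S ^t* *m x) b 0) <= cS * a by apply: hS.
have p0 tau t : 0 <= profile rho k tau t.
  case/andP: k01 => k0 _; have rho0 := ltW (lt_trans ltr01 rho1).
  by rewrite /profile; case: ifP => _; rewrite ?mulr_ge0 ?exprn_ge0.
suff [y [u [y0 yrec ya ua]]] : exists (y : nat -> 'cV[F]_n.+1) (u : nat -> 'cV[F]_m),
  [/\ y 0%N = S ^t* *m x,
   forall t, (t < size s)%N ->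
     y t.+1 = diag_mx mu *m y t - (C *m S) ^t* *m ((nth false s t)%:R *: u t),
   forall t b, (t <= size s)%N -> normc (y t b 0) <=
     (c + 1) * cS * a * profile rho k (delay (2 * N) n.+1 0 s) t &
   forall t j, (t <= size s)%N -> normc (u t j 0) <=
     (c + 1) * cS * a * profile rho k (delay (2 * N) n.+1 0 s) t].
  rewrite {1}xE -y0.
  apply: le_trans (hp _ _ _ y u (delay_le_size _ _ _ _) yrec ya ua) _.
  by rewrite lecR le_eqVlt; apply/orP; left; apply/eqP; ring.
have [dE|[T [_ Tb Tg Tn]]] := delay_times (2 * N) n 0 s.
  exists (fun t => \col_b (mu 0 b ^+ t * (S ^t* *m x) b 0)), (fun=> 0); split.
  - by apply/colP => b; rewrite mxE expr0 mul1r.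
  - move=> t _; rewrite scaler0 mulmx0 subr0 mul_diag_mx.
    by apply/colP => b; rewrite !mxE exprS mulrA.
  - move=> t b ht; rewrite /profile dE ht mxE ComplexField.Normc.normcM normcX.
    rewrite mulrC; apply: ler_pM; rewrite ?exprn_ge0 ?normc_ge0 //.
      apply: le_trans (va b) _; rewrite -mulrA; apply: ler_peMl.
        by rewrite mulr_ge0.
      by rewrite lerDr.
    by rewrite lerXn2r ?nnegrE ?normc_ge0 // ltW // (lt_trans ltr01).
  - by move=> t j _; rewrite mxE ComplexField.Normc.normc0 !mulr_ge0.
have T0 i : (i <= n)%N -> (0 < T i)%N by move/Tb/andP => [].
have [y [u [y0 yrec u0 ya ua]]] := hN T T0 Tg _ _ va.
rewrite -Tn.
have weaken (p q : K) : 0 <= q -> p <= c * (cS * a) * q -> p <= (c + 1) * cS * a * q.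
  move=> q0 h; apply: le_trans h _; apply: ler_wpM2r => //.
  by rewrite -!mulrA; apply: ler_wpM2r; rewrite ?mulr_ge0 // lerDl.
exists y, u; split=> // [t _|t b _|t j _]; [|exact: weaken|exact: weaken].
rewrite yrec; congr (_ - _ *m _).
(* The arrival indicator can be inserted freely: the input is zero except just before a selected
   time, and there the letter is [true]. *)
have [_|nb] := boolP (nth false s t); first by rewrite scale1r.
rewrite scale0r u0 // => i ni; apply: contraNneq nb => Ti.
by have := Tb i ni; rewrite Ti => /andP[].
Qed.

End PathwiseBound.

(** * Weighted sums over binary words *)

Section Words.
Variable K : realType.

Fixpoint words (k : nat) : seq (seq bool) :=
  if k is k'.+1 then map (cons true) (words k') ++ map (cons false) (words k')
  else [:: [::]].

Definition weight (p : K) (s : seq bool) : K := \prod_(b <- s) (if b then p else 1 - p).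

Lemma weight_cons p b s : weight p (b :: s) = (if b then p else 1 - p) * weight p s.
Proof. by rewrite /weight big_cons. Qed.

Lemma weight_ge0 p s : 0 <= p <= 1 -> 0 <= weight p s.
Proof.
by case/andP=> p0 p1; apply: prodr_ge0 => -[] _ //; rewrite subr_ge0.
Qed.

Lemma sum_words (V : nmodType) k (f : seq bool -> V) :
  \sum_(s <- words k.+1) f s =
  \sum_(s <- words k) f (true :: s) + \sum_(s <- words k) f (false :: s).
Proof. by rewrite /= big_cat !big_map. Qed.

Lemma sum_weight_words p k (f : seq bool -> K) :
  \sum_(s <- words k.+1) weight p s * f s =
  p * \sum_(s <- words k) weight p s * f (true :: s) +
  (1 - p) * \sum_(s <- words k) weight p s * f (false :: s).
Proof.
rewrite sum_words !mulr_sumr; congr (_ + _); apply: eq_bigr => s _.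
  by rewrite weight_cons mulrA.
by rewrite weight_cons mulrA.
Qed.

Lemma sum_weight p k : \sum_(s <- words k) weight p s = 1.
Proof.
under eq_bigr do rewrite -[weight _ _]mulr1.
elim: k => [|k IH]; first by rewrite big_seq1 /weight big_nil mulr1.
by rewrite sum_weight_words IH; ring.
Qed.

Lemma size_words k s : s \in words k -> size s = k.
Proof.
elim: k s => [|k IH] s; first by rewrite inE => /eqP->.
by rewrite mem_cat => /orP[] /mapP[t /IH <- ->].
Qed.

Lemma sum_words_eq (V : nmodType) k (s : seq bool) (f : seq bool -> V) : size s = k ->
  \sum_(t <- words k | t == s) f t = f s.
Proof.
elim: k s f => [|k IH] [|b s] f //= => [_|[sk]].
  by rewrite big_mkcond big_seq1 eqxx.
rewrite big_mkcond /= big_cat !big_map /= -!big_mkcond /=.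
case: b => /=; under [X in X + _]eq_bigl do rewrite eqseq_cons /=;
  under [X in _ + X]eq_bigl do rewrite eqseq_cons /=.
  by rewrite big_pred0_eq addr0 (IH s (fun t => f (true :: t))).
by rewrite big_pred0_eq add0r (IH s (fun t => f (false :: t))).
Qed.

Lemma sum_weight_exprS p (R : K) k (e : seq bool -> nat) :
  \sum_(s <- words k) weight p s * R ^+ (e s).+1 =
  R * \sum_(s <- words k) weight p s * R ^+ e s.
Proof. by rewrite mulr_sumr; apply: eq_bigr => s _; rewrite exprS mulrCA. Qed.

(* Each round costs a factor [R ^+ g] times a geometric sum with ratio [q R]. *)
Lemma mean_delay_bound (p R : K) g r w : 0 <= p <= 1 -> 0 <= R -> (1 - p) * R < 1 ->
  exists2 c, 0 <= c & forall k,
    \sum_(s <- words k) weight p s * R ^+ delay g r w s <= c.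
Proof.
move=> /andP[p0 p1] R0 qR; elim: r w => [|r IHr] w.
  exists 1 => // k; rewrite -(sum_weight p k); apply: ler_sum => s _.
  by case: s => [|b s] /=; rewrite expr0 mulr1.
have q0 : 0 <= 1 - p by rewrite subr_ge0.
elim: w => [|w [c c0 IH]].
  have [c c0 hc] := IHr g; have q1 : 0 < 1 - (1 - p) * R by rewrite subr_gt0.
  (* This is the solution [D] of [D = 1 + p R c + (1 - p) R D]: selection, waiting, and 1 for the
     empty word. *)
  exists ((1 + p * R * c) / (1 - (1 - p) * R)).
    by rewrite divr_ge0 ?(ltW q1) // addr_ge0 // !mulr_ge0.
  elim=> [|k IH].
    rewrite big_seq1 /weight big_nil mul1r expr0 ler_pdivlMr // mul1r.
    by rewrite lerBlDr -addrA lerDl addr_ge0 ?mulr_ge0.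
  rewrite sum_weight_words /= !sum_weight_exprS !mulrA.
  apply: le_trans (_ : p * R * c + (1 - p) * R * ((1 + p * R * c) / (1 - (1 - p) * R)) <= _).
    by apply: lerD; apply: ler_wpM2l; rewrite ?mulr_ge0.
  set D := _ / _; have : D * (1 - (1 - p) * R) = 1 + p * R * c.
    by rewrite divfK // gt_eqF.
  lra.
(* A skipped letter costs one factor [R] whatever its value; the 1 covers the empty word. *)
exists (1 + R * c) => [|[|k]]; first by rewrite addr_ge0 // mulr_ge0.
  by rewrite big_seq1 /weight big_nil mul1r expr0 lerDl mulr_ge0.
rewrite sum_weight_words /= !sum_weight_exprS -mulrDl addrC subrK mul1r.
by apply: ler_wpDl => //; apply: ler_wpM2l.
Qed.

End Words.

(** * Law of the arrival word *)

Section BernoulliWords.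
Context {K : realType} {d : measure_display} {Omega : measurableType d}.
Variables (Pr : probability Omega K) (gamma : nat -> {RV Pr >-> bool}) (p : K).
Hypothesis iid : iid_bernoulli gamma p.

Definition arrival_word k (w : Omega) := rev (mkseq (fun l => gamma l w) k).

Let event k s := [set w | arrival_word k w = s]%classic.

Lemma measurable_arrival l (B : set bool) : measurable (gamma l @^-1` B)%classic.
Proof. exact: measurable_funPTI. Qed.

Lemma arrival_prob l b : Pr (gamma l @^-1` [set b])%classic = (if b then p else 1 - p)%:E.
Proof.
case: b; first by case: iid.
have -> : (gamma l @^-1` [set false] = ~` (gamma l @^-1` [set true]))%classic.
  by apply/seteqP; split=> w /=; case: (gamma l w).
rewrite probability_setC; last exact: measurable_arrival.
by case: iid => _ ->.
Qed.

(** This is the form to which mutual independence applies; the reversal is there because words list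
    the latest arrival first. *)
Lemma event_bigcap k s : size s = k ->
  event k s = (\bigcap_(l in [set` [fset l in iota 0 k]%fset])
     (gamma l @^-1` [set nth false (rev s) l]))%classic.
Proof.
move=> sk; apply/seteqP; split=> w /=.
  move=> <- l /=; rewrite in_fset mem_iota => lk /=.
  by rewrite revK nth_mkseq.
move=> h; rewrite /event /= /arrival_word -[RHS]revK; congr rev.
apply: (@eq_from_nth _ false); first by rewrite size_mkseq size_rev.
move=> l; rewrite size_mkseq => lk; rewrite nth_mkseq //.
by apply: h; rewrite /= in_fset mem_iota.
Qed.

Lemma measurable_event k s : measurable (event k s).
Proof.
have [sk|sk] := eqVneq (size s) k; last first.
  rewrite (_ : event k s = set0) //; apply/seteqP; split=> // w ws; case/eqP: sk.
  by rewrite -ws size_rev size_mkseq.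
rewrite event_bigcap //; apply: fin_bigcap_measurable => // l _.
exact: measurable_arrival.
Qed.

Lemma event_prob k s : size s = k -> Pr (event k s) = (weight p s)%:E.
Proof.
move=> sk; rewrite event_bigcap //.
case: iid => indep _.
rewrite (indep [fset l in iota 0 k]%fset (fun l => [set nth false (rev s) l]%classic)).
under eq_bigr do rewrite arrival_prob.
rewrite prodEFin; congr _%:E.
rewrite (perm_big (iota 0 k)) /=; last first.
  apply: uniq_perm; rewrite ?fset_uniq ?iota_uniq // => l; exact: in_fset.
rewrite /weight -(perm_big _ (permEl (perm_rev s))) /=.
by rewrite (big_nth false) size_rev sk /index_iota subn0.
Qed.

(** The variable takes finitely many values: it is the sum over words [s] of [X s] times the
    indicator that [s] occurs. *)
Lemma mean_word (X : seq bool -> K) k :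
  fine ('E_Pr[fun w => X (arrival_word k w)])%E = \sum_(s <- words k) weight p s * X s.
Proof.
have sz w : size (arrival_word k w) = k by rewrite size_rev size_mkseq.
rewrite unlock.
pose f s w : \bar K := ((X s)%:E * (\1_(event k s) w)%:E)%E.
have f_int s : Pr.-integrable setT (f s).
  by apply: integrableZl => //; apply: integrable_indic; apply: measurable_event.
have fE w : (X (arrival_word k w))%:E = (\sum_(s <- words k) f s w)%E.
  rewrite -(sum_words_eq (fun s => (X s)%:E) (sz w)) big_mkcond /=.
  apply: eq_bigr => s _; rewrite /f indicE; case: eqP => [->|h].
    by rewrite mem_set ?mule1.
  by rewrite memNset ?mule0 //; apply: nesym.
under eq_integral do rewrite fE.
rewrite integral_sum //.
rewrite big_seq (eq_bigr (fun s => (weight p s * X s)%:E)) -?big_seq.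
  by rewrite sumEFin.
move=> s /size_words sk; rewrite integralZl //; last first.
  by apply: integrable_indic; apply: measurable_event.
rewrite integral_indic //; last exact: measurable_event.
rewrite setIT mulrC EFinM; congr (_ * _)%E; exact: event_prob.
Qed.

End BernoulliWords.

(** * Growth and boundedness of the mean covariance *)

Section MeanCovariance.
Context {K : realType} {d : measure_display} {Omega : measurableType d}.
Local Notation F := K[i].
Variables (Pr : probability Omega K) (gamma : nat -> {RV Pr >-> bool}) (p : K).
Hypotheses (iid : iid_bernoulli gamma p) (p01 : 0 <= p <= 1).
Variables (m n : nat) (A : 'M[F]_n.+1) (C : 'M[F]_(m, n.+1)) (Q : 'M[F]_n.+1)
  (R : 'M[F]_m) (Sigma0 S : 'M[F]_n.+1) (lam : 'rV[F]_n.+1).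
Hypotheses (hdiag : diagonalizes S A lam) (pQ : psdmx Q) (pR : posdefmx R)
  (pS : posdefmx Sigma0).

Local Notation word_cov := (word_cov A C Q R Sigma0).
Local Notation mean_cov k := (mean_kalman_cov gamma A C Q R Sigma0 k).

Let wpsd s : psdmx (word_cov s).
Proof. exact: (@word_cov_psd _ _ _ A C Q R pQ pR Sigma0 (posdefmx_psd pS) s). Qed.

Lemma mean_kalman_cov_words k :
  mean_cov k = \sum_(s <- words k) (weight p s)%:C *: word_cov s.
Proof.
apply/matrixP => i j; rewrite mxE summxE /cexpectation.
have covE w : kalman_cov A C Q R Sigma0 (fun l => gamma l w) k =
    word_cov (arrival_word gamma k w) by rewrite kalman_cov_word.
have -> : (fun w => complex.Re (kalman_cov A C Q R Sigma0 (fun l => gamma l w) k i j)) =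
    (fun w => complex.Re (word_cov (arrival_word gamma k w) i j)).
  by apply/funext => w; rewrite covE.
have -> : (fun w => complex.Im (kalman_cov A C Q R Sigma0 (fun l => gamma l w) k i j)) =
    (fun w => complex.Im (word_cov (arrival_word gamma k w) i j)).
  by apply/funext => w; rewrite covE.
rewrite (mean_word iid (fun s => complex.Re (word_cov s i j))).
rewrite (mean_word iid (fun s => complex.Im (word_cov s i j))).
elim: (words k) => [|s l IH]; first by rewrite !big_nil.
rewrite !big_cons -IH mxE; case: (word_cov s i j) => a b /=.
by apply/eqP; rewrite eq_complex /= !mul0r subr0 addr0 !eqxx.
Qed.

Lemma qform_mean k x : qform (mean_cov k) x =
  \sum_(s <- words k) (weight p s)%:C * qform (word_cov s) x.
Proof.
rewrite mean_kalman_cov_words; elim: (words k) => [|s l IH].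
  by rewrite !big_nil /qform mulmx0 mul0mx mxE.
by rewrite !big_cons qformD qformZ IH.
Qed.

Lemma mean_cov_herm k : mean_cov k \is hermsymmx.
Proof.
rewrite mean_kalman_cov_words; elim/big_ind: _ => [|P1 P2|s _].
- by apply/hermsymmxP; rewrite trmx0 map_mx0.
- exact: hermsymmxD.
- apply: hermsymmxZ; last by case: (wpsd s).
  by apply/ger0_real; rewrite ler0c weight_ge0.
Qed.

Let mean_form k x := \sum_(s <- words k) weight p s * complex.Re (qform (word_cov s) x).

Let Re_qform s x : qform (word_cov s) x = (complex.Re (qform (word_cov s) x))%:C.
Proof. by rewrite (RRe_real (ger0_real (psd_qform_ge0 x (wpsd s)))). Qed.

Let Re_qform_ge0 s x : 0 <= complex.Re (qform (word_cov s) x).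
Proof. by rewrite -ler0c -Re_qform; exact: psd_qform_ge0 (wpsd s). Qed.

Let weighted_ge0 k (h : seq bool -> seq bool) x :
  0 <= \sum_(s <- words k) weight p s * complex.Re (qform (word_cov (h s)) x).
Proof.
by apply: sumr_ge0 => s _; exact: mulr_ge0 (weight_ge0 s p01) (Re_qform_ge0 _ x).
Qed.

Let qform_mean_form k x : qform (mean_cov k) x = (mean_form k x)%:C.
Proof.
rewrite qform_mean rmorph_sum /=; apply: eq_bigr => s _.
by rewrite rmorphM /= -Re_qform.
Qed.

(** The first basis vector of the diagonal coordinates, carried back by [S^-H]. *)
Lemma adj_eigenvector : exists2 x : 'cV[F]_n.+1, x != 0 &
  A ^t* *m x = (lam 0 0)^*%R *: x.
Proof.
have [uS _] := hdiag; pose e : 'cV[F]_n.+1 := delta_mx 0 0.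
exists ((invmx S) ^t* *m e).
  apply: contra_neq (oner_neq0 F) => h.
  have : S ^t* *m ((invmx S) ^t* *m e) = 0 by rewrite h mulmx0.
  rewrite mulmxA -adjmxM mulVmx // trmx1 map_mx1 mul1mx => /colP/(_ 0).
  by rewrite !mxE !eqxx.
have := dual_dynamics C hdiag e 0; rewrite !mulmx0 !subr0 => <-.
rewrite scalemxAr; congr (_ *m _); rewrite mul_diag_mx; apply/colP => i.
rewrite !mxE; case: eqP => [->|_]; first by rewrite mulr1.
by rewrite mulr0 mulr0.
Qed.

Lemma qform_scale (P : 'M[F]_n.+1) a x :
  qform P (a *: x) = (normc a ^+ 2)%:C * qform P x.
Proof.
have aE : (a *: x) ^t* = a^*%R *: x ^t* by apply/matrixP => i j; rewrite !mxE rmorphM.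
rewrite /qform aE -!scalemxAl -scalemxAr scalerA [LHS]mxE.
by congr (_ * _); rewrite rmorphXn /= -normr_normc normCK mulrC.
Qed.

Lemma mean_cov_unbounded : 1 < (1 - p) * normc (lam 0 0) ^+ 2 ->
  ~ mean_cov_bounded gamma A C Q R Sigma0.
Proof.
move=> big [M hM]; have [x x0 Ax] := adj_eigenvector.
have q0 : 0 <= 1 - p by case/andP: p01 => _ p1; rewrite subr_ge0.
have p0 : 0 <= p by case/andP: p01.
set g := (1 - p) * _ in big.
have grow k : g ^+ k * mean_form 0 x <= mean_form k x.
  elim: k => [|k IH]; first by rewrite expr0 mul1r.
  rewrite [leRHS]/mean_form sum_weight_words.
  apply: le_trans (_ : g * mean_form k x <= _).
    by rewrite exprS -mulrA; apply: ler_wpM2l => //; rewrite ltW // (lt_trans ltr01).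
  (* The words whose latest measurement arrives are dropped, since they contribute a nonnegative
     amount. *)
  apply: ler_wpDl; first exact: mulr_ge0 p0 (weighted_ge0 k (cons true) x).
  rewrite /g -mulrA; apply: (ler_wpM2l q0); rewrite mulr_sumr.
  apply: ler_sum => s _; rewrite mulrCA; apply: ler_wpM2l; first exact: weight_ge0.
  rewrite -lecR rmorphM /= -!Re_qform.
  have := riccati_ge_open_loop A C R pQ x (wpsd s).
  rewrite Ax qform_scale normc_conj => h; apply: le_trans h _.
  by have /= <- := Re_qform (false :: s) x.
have m0 : 0 < mean_form 0 x.
  rewrite /mean_form big_seq1 /weight big_nil mul1r -ltcR -Re_qform.
  by case: pS => _; apply.
have Mge k : mean_form k x <= complex.Re (qform M x).
  have := (hM k).2 x; rewrite -/(qform _ _) qformB subr_ge0 qform_mean_form.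
  by rewrite lecE /= => /andP[_].
have g0 : 0 < g := lt_trans ltr01 big.
have g01 : 0 <= g^-1 < 1 by rewrite invr_ge0 (ltW g0) invf_lt1.
(* For this [N] the bound from [M] is at most half of [g ^+ N * mean_form 0 x], which contradicts
   the growth. *)
have [N hN] := geometric_small (complex.Re (qform M x)) g01 (divr_gt0 m0 (ltr0n K 2)).
have := le_trans (grow N) (Mge N).
rewrite exprVn ler_pdivrMr ?exprn_gt0 // in hN => h.
have := le_trans h hN; rewrite mulrC ler_pM2r ?exprn_gt0 //; lra.
Qed.

Hypotheses (lam_sort : forall i j : 'I_n.+1, (i <= j)%N ->
    normc (lam 0 j) <= normc (lam 0 i))
  (hnondeg : forall I : {set 'I_n.+1}, equi_block lam I ->
       (forall i, i \in I -> 1 <= `|lam 0 i|) -> nondegenerate_block (C *m S) I).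

(** The pathwise bound is averaged by [mean_delay_bound] at ratio [rho ^+ 2]. A scalar matrix
    suffices as bound, because the squared largest entry of [x] is at most [x^H x]. *)
Lemma mean_cov_bounded_of_rate (rho : K) : 1 < rho -> normc (lam 0 0) <= rho ->
  (1 - p) * rho ^+ 2 < 1 -> mean_cov_bounded gamma A C Q R Sigma0.
Proof.
move=> rho1 lam_rho q_rho.
have lam_le i : normc (lam 0 i) <= rho by apply: le_trans lam_rho; apply: lam_sort.
have [g [c [c0 hc]]] :=
  word_cov_delay_bound hdiag pQ pR (posdefmx_psd pS) lam_sort hnondeg rho1 lam_le.
have [c2 c20 hc2] := mean_delay_bound g n.+1 0 p01 (sqr_ge0 rho) q_rho.
exists ((c * c2)%:C%:M) => k; split.
  apply: hermsymmxB; last exact: mean_cov_herm.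
  by apply: hermsymmx_scalar; apply/ger0_real; rewrite ler0c mulr_ge0.
move=> x; rewrite -/(qform _ _) qformB subr_ge0 qform_mean_form.
have [b _ bmax] := arg_maxP (fun i => normc (x i 0)) (erefl (xpredT (@ord0 n))).
have xb i : normc (x i 0) <= normc (x b 0) by apply: bmax.
have -> : qform (c * c2)%:C%:M x = (c * c2 * \sum_i normc (x i 0) ^+ 2)%:C.
  rewrite /qform scalar_mxC -mulmxA mul_scalar_mx mxE [RHS]rmorphM /=; congr (_ * _).
  rewrite mxE rmorph_sum; apply: eq_bigr => i _ /=.
  by rewrite !mxE rmorphXn /= -normr_normc normCK mulrC.
rewrite lecR.
apply: le_trans (_ : c * c2 * normc (x b 0) ^+ 2 <= _); last first.
  apply: ler_wpM2l; first exact: mulr_ge0.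
  by rewrite (bigD1 b) //= lerDl; apply: sumr_ge0 => i _; apply: sqr_ge0.
apply: le_trans (_ : c * normc (x b 0) ^+ 2 *
    \sum_(s <- words k) weight p s * (rho ^+ 2) ^+ delay g n.+1 0 s <= _).
  rewrite mulr_sumr; apply: ler_sum => s _; rewrite mulrCA.
  by apply: ler_wpM2l; rewrite ?weight_ge0 // -lecR -Re_qform hc.
by rewrite mulrAC; apply: ler_wpM2r; rewrite ?sqr_ge0 // ler_wpM2l.
Qed.

End MeanCovariance.

(** * The threshold formula and the critical value *)

Lemma rate_margin (K : realType) (q r : K) : 0 <= q < 1 -> 0 <= r -> q * r ^+ 2 < 1 ->
  exists rho, [/\ 1 < rho, r <= rho & q * rho ^+ 2 < 1].
Proof.
move=> /andP[q0 q1] r0 qr; pose t := Num.max 1 r.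
have t1 : 1 <= t by rewrite le_max lexx.
have qt : q * t ^+ 2 < 1.
  by rewrite /t; case: (leP 1 r) => // _; rewrite expr1n mulr1.
(* As [e <= 1], the increase [q * e * (2 * t + e)] is at most [e * (2 * t + 1)], half of the slack
   [1 - q * t ^+ 2]. *)
pose e := (1 - q * t ^+ 2) / (2 * (2 * t + 1)).
have d0 : 0 < 2 * (2 * t + 1) by lra.
have e0 : 0 < e by rewrite divr_gt0 // subr_gt0.
have eE : e * (2 * (2 * t + 1)) = 1 - q * t ^+ 2 by rewrite divfK // gt_eqF.
have qt0 : 0 <= q * t ^+ 2 by rewrite mulr_ge0 ?sqr_ge0.
have e1 : e <= 1 by rewrite ler_pdivrMr //; lra.
exists (t + e); split; first by lra.
  by rewrite (le_trans (_ : r <= t)) ?le_max ?lexx ?orbT // lerDl ltW.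
have -> : q * (t + e) ^+ 2 = q * t ^+ 2 + q * (e * (2 * t + e)) by ring.
have h1 : e * (2 * t + e) <= e * (2 * t + 1).
  by apply: ler_wpM2l; [exact: ltW | lra].
have h2 : q * (e * (2 * t + e)) <= e * (2 * t + e).
  by apply: ler_piMl; [rewrite mulr_ge0 //; lra | exact: ltW].
lra.
Qed.

Lemma critical_formula_lt1 (K : realType) (z : K[i]) : critical_formula z < 1.
Proof.
rewrite /critical_formula; case: eqVneq => [_|z0]; first exact: ltr01.
rewrite gt_max ltr01 andbT gtrBl invr_gt0 exprn_gt0 // lt_def normc_ge0 andbT.
by apply: contra_neq z0; apply: ComplexField.Normc.eq0_normc.
Qed.

Lemma critical_formula_ge0 (K : realType) (z : K[i]) : 0 <= critical_formula z.
Proof.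
by rewrite /critical_formula; case: ifP => _ //; rewrite le_max lexx orbT.
Qed.

Lemma lt_critical_formula (K : realType) (z : K[i]) (p : K) : 0 <= p ->
  p < critical_formula z -> 1 < (1 - p) * normc z ^+ 2.
Proof.
move=> p0; rewrite /critical_formula; case: eqVneq => [_|z0]; first by rewrite ltNge p0.
have r0 : 0 < normc z.
  rewrite lt_def normc_ge0 andbT; apply: contra_neq z0.
  exact: ComplexField.Normc.eq0_normc.
rewrite lt_max [p < 0]ltNge p0 orbF ltrBrDr -ltrBrDl => h.
by rewrite -ltr_pdivrMr ?exprn_gt0 // div1r.
Qed.

Lemma gt_critical_formula (K : realType) (z : K[i]) (p : K) :
  critical_formula z < p -> (1 - p) * normc z ^+ 2 < 1.
Proof.
rewrite /critical_formula; case: eqVneq => [-> _|z0].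
  by rewrite ComplexField.Normc.normc0 expr0n mulr0 ltr01.
have r0 : 0 < normc z.
  rewrite lt_def normc_ge0 andbT; apply: contra_neq z0.
  exact: ComplexField.Normc.eq0_normc.
rewrite gt_max => /andP[h _].
by rewrite -ltr_pdivlMr ?exprn_gt0 // div1r ltrBlDr -ltrBlDl.
Qed.

Theorem theorem4 (K : realType) (m n : nat)
    (A : 'M[K[i]]_n.+1) (C : 'M[K[i]]_(m, n.+1))
    (Q : 'M[K[i]]_n.+1) (R : 'M[K[i]]_m) (Sigma0 : 'M[K[i]]_n.+1)
    (S : 'M[K[i]]_n.+1) (lam : 'rV[K[i]]_n.+1)
    (d : K -> measure_display)
    (Omega : forall p : K, measurableType (d p))
    (Pr : forall p : K, probability (Omega p) K)
    (gamma : forall p : K, nat -> {RV (Pr p) >-> bool})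
    (hgamma : forall p : K, 0 <= p <= 1 -> iid_bernoulli (gamma p) p)
    (hdiag : diagonalizes S A lam)
    (hsort : forall i j : 'I_n.+1, (i <= j)%N -> `|lam 0 j| <= `|lam 0 i|)
    (hdet : detectable C A)
    (hQ : posdefmx Q) (hSigma0 : posdefmx Sigma0) (hR : posdefmx R)
    (hnondeg : forall I : {set 'I_n.+1}, equi_block lam I ->
       (forall i, i \in I -> 1 <= `|lam 0 i|) -> nondegenerate_block (C *m S) I) :
  critical_value gamma A C Q R Sigma0 = critical_formula (lam 0 ord0).
Proof.
have sort_normc (i j : 'I_n.+1) : (i <= j)%N -> normc (lam 0 j) <= normc (lam 0 i).
  by move=> ij; rewrite -le_normr_normc; apply: hsort.
have pQ := posdefmx_psd hQ.
set pc := critical_formula _; rewrite /critical_value; set E := (X in inf X).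
have E_above p : pc < p -> p <= 1 -> E p.
  move=> pcp p1; have p0 : 0 < p := le_lt_trans (critical_formula_ge0 _) pcp.
  have p01 : 0 <= p <= 1 by rewrite (ltW p0).
  have q01 : 0 <= 1 - p < 1 by rewrite subr_ge0 p1 gtrBl.
  have [rho [rho1 r_rho q_rho]] :=
    rate_margin q01 (normc_ge0 _) (gt_critical_formula pcp).
  split=> //; exact: (mean_cov_bounded_of_rate (hgamma p p01) p01 hdiag pQ hR hSigma0
    sort_normc hnondeg rho1 r_rho q_rho).
have E_lb : lbound E pc.
  move=> p [p01 bounded_p]; rewrite leNgt; apply/negP => ppc.
  have /andP[p0 _] := p01; have big := lt_critical_formula p0 ppc.
  exact: (mean_cov_unbounded (hgamma p p01) p01 hdiag pQ hR hSigma0 big bounded_p).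
have pc1 : pc < 1 := critical_formula_lt1 _.
(* The infimum is over a nonempty set, as [pc] lies strictly below 1. *)
have E1 : E 1 by apply: E_above.
apply/eqP; rewrite eq_le; apply/andP; split; last by apply: lb_le_inf => //; exists 1.
have hlb : has_lbound E by exists pc.
rewrite leNgt; apply/negP => pc_inf; have inf1 : inf E <= 1 by apply: ge_inf.
(* If [pc] were below the infimum, their midpoint would be a bounded rate smaller than the
   infimum. *)
have : inf E <= (pc + inf E) / 2 by apply: ge_inf => //; apply: E_above; lra.
lra.
Qed.
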